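(* Let $M$ be a prime and let $q$ be a prime power with $(M,q)=1$. Let $t$ be the order of $q$ in $(\mathbb Z/M\mathbb Z)^{\times}$. Then for every positive integer $n<Mt$, $$\frac{|\mathrm{GL}(n,q)^M|}{|\mathrm{GL}(n,q)|}=\sum_{\substack{\lambda\vdash n\\ \lambda=1^{m_1}2^{m_2}\cdots}}\frac{1}{M^{\pi_t(\lambda)}\prod_{i\geq 1}i^{m_i}m_i!}.$$
   Context: $\mathrm{GL}(n,q)$ is the group of invertible $n\times n$ matrices over the field with $q$ elements, and $\mathrm{GL}(n,q)^M=\{x^M\mid x\in\mathrm{GL}(n,q)\}$. The sum is over all partitions $\lambda$ of $n$; $\lambda=1^{m_1}2^{m_2}\cdots$ means that $i$ occurs $m_i$ times as a part of $\lambda$, and $\pi_t(\lambda)$ denotes the number of parts of $\lambda$ (counted with multiplicity) that are divisible by $t$. *)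

(* Defs.v *)
From mathcomp Require Import all_boot.

Set Implicit Arguments.
Unset Strict Implicit.
Unset Printing Implicit Defensive.

Definition is_partition (n : nat) (l : seq nat) : bool :=
  [&& sorted geq l, 0 \notin l & sumn l == n].

(* A partition of n has at most n parts, each at most n, hence the finite     *)
(* search space n.-bseq 'I_n.+1; see mem_partitions and uniq_partitions.      *)
Definition partitions (n : nat) : seq (seq nat) :=
  [seq l <- [seq [seq val i | i <- b] | b : n.-bseq 'I_n.+1]
     | is_partition n l].

Definition part_mult (i : nat) (l : seq nat) : nat := count_mem i l.

Definition parts_divisible (t : nat) (l : seq nat) : nat := count (dvdn t) l.

(* The product over all i >= 1 is cut at sumn l, beyond which part_mult i l   *)
(* is 0 and the factor is 1.                                                  *)
Definition centralizer_order (l : seq nat) : nat :=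
  \prod_(1 <= i < (sumn l).+1) (i ^ part_mult i l * (part_mult i l)`!).

Lemma mem_partitions (n : nat) (l : seq nat) :
  (l \in partitions n) = is_partition n l.
Proof.
rewrite mem_filter; case: (boolP (is_partition n l)) => //= lP.
have /and3P[_ l0 /eqP sl] := lP.
have le_sz : size l <= n.
  rewrite -sl; elim: l l0 {lP sl} => //= x l IH.
  rewrite inE negb_or => /andP[x0 /IH].
  by rewrite -add1n; apply: leq_add; rewrite lt0n eq_sym.
have le_n : all (fun x => x < n.+1) l.
  apply/allP => x xl; rewrite ltnS -sl.
  elim: l xl {l0 lP sl le_sz} => //= y l IH; rewrite inE.
  by case/orP => [/eqP->|/IH h]; [apply: leq_addr|apply: (leq_trans h); apply: leq_addl].
pose b : seq 'I_n.+1 := [seq inord x | x <- l].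
have sb : size b <= n by rewrite size_map.
apply/imageP; exists (Bseq sb) => //=.
rewrite -map_comp -[LHS]map_id; apply/eq_in_map => x xl /=.
by rewrite inordK // (allP le_n).
Qed.

Lemma uniq_partitions (n : nat) : uniq (partitions n).
Proof.
apply: filter_uniq; rewrite map_inj_uniq ?enum_uniq //.
by move=> b c /(inj_map val_inj) /val_inj.
Qed.

(* Main.v *)
Require Import Defs.
From mathcomp Require Import all_boot all_order all_algebra all_fingroup.
From mathcomp Require Import all_solvable all_field qpoly qfpoly ring.

Set Implicit Arguments.
Unset Strict Implicit.
Unset Printing Implicit Defensive.

Import GRing.Theory.
Local Open Scope ring_scope.

(** Why the formula holds.  Let F be the field with q elements.  For n < M t,
    whether x in GL_n is an M-th power depends only on the irreducible factors
    of its characteristic polynomial.  Let M^a be the M-part of q^t - 1; it is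
    also the M-part of q^k - 1 for every multiple k < M t of t.  Take
    r = M^(a-1) r', where r' is the product of the prime-to-M parts of all
    q^k - 1 with 0 < k < M t.  An eigenvalue of an invertible matrix of size
    n < M t has some degree k < M t over F, so its order divides q^k - 1, which
    divides M r; hence all eigenvalues of an M-th power are r-th roots of unity.
    Conversely, if all eigenvalues of x are r-th roots of unity, a power of x
    with exponent prime to M is killed by M^(a-1), and a nontrivial root of
    unity of order dividing M^(a-1) generates a field containing the M^a-th
    roots of unity, in which it is an M-th power; the Chinese remainder theorem
    then gives an M-th root of that power of x as a polynomial in x, and Bezout
    an M-th root of x itself.  So x is an M-th power if
    and only if every irreducible factor of its characteristic polynomial
    divides X^r - 1 ([unit_power_char_poly]).  Call such polynomials good; this
    is a multiplicative condition.

    Let A(z) have coefficients the proportions sought, and G(z) the numbers of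
    good monic polynomials of each degree.  Counting pairs of a matrix x and a
    vector v according to the cyclic subspace that v generates under x gives
    A(qz) = G(z) A(z) ([card_char_rec]).  By unique factorization
    z G' = E G, where e_k is the sum of the degrees of the good monic
    irreducible polynomials of degree dividing k ([card_monic_rec]); that is the
    degree of gcd(X^r - 1, X^(q^k - 1) - 1), so e_k = gcd(r, q^k - 1)
    ([sum_degree_irr_factors]), which is c_k (q^k - 1) for 0 < k < M t, where
    c_k = 1/M if t divides k and c_k = 1 otherwise ([gcdn_root_order]).

    On the other side, deleting one part from a partition shows that the series
    B(z) of the partition sums satisfies z B' = C B ([partition_sum_rec]).
    Then G(z) B(z) and B(qz) both have logarithmic derivative C(qz), since
    e_k + c_k = c_k q^k, so B(qz) = G(z) B(z), an equation that determines its
    solution from its constant term ([dilation_equation_unique]). *)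

(** * Krylov matrices *)

Section Krylov.
Variables (F : fieldType) (n : nat).
Implicit Types (k : nat) (x : 'M[F]_n) (v : 'rV[F]_n).

Definition krylov k x v : 'M_(k, n) := \matrix_(i < k) (v *m x ^+ i).

Lemma row_krylov k x v (i : 'I_k) : row i (krylov k x v) = v *m x ^+ i.
Proof. exact: rowK. Qed.

Lemma eqmx_krylovS k x v :
  (krylov k.+1 x v :=: krylov k x v + v *m x ^+ k)%MS.
Proof.
apply/eqmxP/andP; split.
  apply/row_subP=> i; rewrite row_krylov.
  have [lt_ik | ] := ltnP i k.
    rewrite (submx_trans _ (addsmxSl _ _)) //.
    by rewrite -(row_krylov x v (Ordinal lt_ik)) row_sub.
  rewrite leq_eqVlt ltnNge -ltnS ltn_ord orbF => /eqP <-.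
  exact: addsmxSr.
rewrite addsmx_sub; apply/andP; split; last first.
  by rewrite -(row_krylov x v ord_max) row_sub.
apply/row_subP=> i; rewrite row_krylov.
by rewrite -(row_krylov x v (widen_ord (leqnSn k) i)) row_sub.
Qed.

Lemma krylov_free_pred k x v :
  row_free (krylov k.+1 x v) -> row_free (krylov k x v).
Proof.
rewrite -!row_leq_rank eqmx_krylovS => le_k.
have := leq_trans le_k (mxrank_adds_leqif _ _).1.
by rewrite -addn1 => /leq_trans/(_ (leq_add (leqnn _) (rank_leq_row _)));
  rewrite leq_add2r.
Qed.

(** A Krylov sequence stays independent exactly until its next vector falls in
    the span of the previous ones. *)
Lemma krylov_free_next k x v : row_free (krylov k x v) ->
  row_free (krylov k.+1 x v) = ~~ (v *m x ^+ k <= krylov k x v)%MS.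
Proof.
move=> free_k; have rk := eqP free_k.
rewrite -row_leq_rank eqmx_krylovS.
case: (boolP (v *m _ <= _)%MS) => [sub_vk | nsub_vk] /=.
  by rewrite (addsmx_idPl sub_vk) rk ltnn.
rewrite -[X in (X < _)%N]rk ltnNge; apply: contra nsub_vk => le_rk.
apply: submx_trans (addsmxSr (krylov k x v) _) _.
by rewrite -(geq_leqif (mxrank_leqif_sup (addsmxSl _ _))).
Qed.

(** For v nonzero, the dimension of the cyclic subspace generated by v is the
    unique length at which the Krylov sequence is free and spans a stable
    subspace: freeness can only be lost as the length grows, it holds for length
    1 and fails for length n + 1, so the sum telescopes. *)
Lemma sum_krylov_stop x v : v != 0 ->
  (\sum_(k < n) (row_free (krylov k.+1 x v)
                 && (v *m x ^+ k.+1 <= krylov k.+1 x v)%MS))%N = 1%N.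
Proof.
move=> v_neq0; pose dep k : nat := ~~ row_free (krylov k.+1 x v).
have dep_mono : {homo dep : i j / (i <= j)%N}.
  apply: homo_leq leq_trans _ => [//|k]; rewrite /dep.
  by have /implyP := @krylov_free_pred k.+1 x v; do 2!case: row_free.
have stopE k : row_free (krylov k.+1 x v)
    && (v *m x ^+ k.+1 <= krylov k.+1 x v)%MS = (dep k.+1 - dep k)%N :> nat.
  rewrite /dep; case: (boolP (row_free (krylov k.+1 x v))) =>
    [free_k | nfree_k].
    by rewrite krylov_free_next // negbK subn0.
  by case: row_free.
have dep0 : dep 0 = 0%N.
  rewrite /dep -row_leq_rank eqmx_krylovS lt0n mxrank_eq0.
  case: (eqVneq (_ + _)%MS 0) => // sum0; case/negP: v_neq0.
  rewrite -submx0 -sum0 -[X in (X <= _)%MS]mulmx1.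
  by rewrite -[1%:M]/(x ^+ 0) addsmxSr.
have depn : dep n = 1%N.
  by rewrite /dep -row_leq_rank -ltnNge ltnS rank_leq_col.
under eq_bigr do rewrite stopE.
rewrite -(big_mkord xpredT (fun k => dep k.+1 - dep k)%N).
by rewrite telescope_sumn // dep0 depn.
Qed.

End Krylov.

(** * Counting matrices by their characteristic polynomial *)

Lemma char_poly_lblock (R : comNzRingType) k m
    (A : 'M[R]_k) (C : 'M[R]_(m, k)) (D : 'M[R]_m) :
  char_poly (block_mx A 0 C D) = char_poly A * char_poly D.
Proof.
rewrite /char_poly -[RHS](det_lblock _ (- map_mx polyC C)); congr (\det _).
rewrite /char_poly_mx map_block_mx map_mx0 scalar_mx_block opp_block_mx.
by rewrite add_block_mx !oppr0 addr0 add0r.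
Qed.

Lemma char_poly_conj (R : comUnitRingType) k (h A : 'M[R]_k) :
  h \in unitmx -> char_poly (h *m A *m invmx h) = char_poly A.
Proof.
move=> Uh; set B := _ *m _.
have hu : h *m invmx h = 1%:M by exact: mulmxV.
have e : map_mx polyC h *m map_mx polyC (invmx h) = 1%:M.
  by rewrite -map_mxM hu map_mx1.
have eB : char_poly_mx B =
    map_mx polyC h *m char_poly_mx A *m map_mx polyC (invmx h).
  rewrite /char_poly_mx mulmxBr mulmxBl -!map_mxM scalar_mxC.
  by rewrite -(mulmxA 'X%:M) e mulmx1.
by rewrite /char_poly eB !det_mulmx mulrAC -det_mulmx e det1 mul1r.
Qed.

(** The monic polynomials of degree k, parametrized by a finite type. *)
Definition monic_of (R : nzRingType) k (w : 'rV[R]_k) : {poly R} :=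
  'X^k - rVpoly w.

Lemma size_monic_of (R : nzRingType) k (w : 'rV[R]_k) :
  size (monic_of w) = k.+1.
Proof.
by rewrite /monic_of size_polyDl size_polyXn // size_polyN ltnS size_poly.
Qed.

Lemma monic_of_monic (R : nzRingType) k (w : 'rV[R]_k) : monic_of w \is monic.
Proof.
by rewrite monicE lead_coefDl ?lead_coefXn // size_polyXn size_polyN ltnS
  size_poly.
Qed.

Lemma coef_monic_of (R : nzRingType) k (w : 'rV[R]_k) (j : 'I_k) :
  (monic_of w)`_j = - w 0 j.
Proof.
by rewrite coefB coefXn ltn_eqF // coef_rVpoly_ord sub0r.
Qed.

(** The companion matrix of [monic_of w], of size syntactically k + 1 so that
    it can be a block of a matrix of size k + 1 + m. *)
Definition companion_of (R : nzRingType) k (w : 'rV[R]_k.+1) : 'M[R]_k.+1 :=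
  \matrix_(i, j) if i == k :> nat then w 0 j else (i.+1 == j :> nat)%:R.

Lemma char_companion_of (R : comNzRingType) k (w : 'rV[R]_k.+1) :
  char_poly (companion_of w) = monic_of w.
Proof.
rewrite -[RHS]companionmxK ?monic_of_monic // /companionmx size_monic_of /=.
congr char_poly; apply/matrixP=> i j; rewrite !mxE.
by rewrite coef_monic_of opprK.
Qed.

Section Completion.
Variable F : finFieldType.
Local Notation q := #|F|.

Definition gl_card m := #|[set A : 'M[F]_m | A \in unitmx]|.

(** The Gaussian factorization of K has an invertible left factor, which is
    extended by an identity block. *)
Lemma row_free_complete k m (K : 'M[F]_(k, k + m)) :
  row_free K -> exists2 h, h \in unitmx & usubmx h = K.
Proof.
move=> freeK; have rk := eqP freeK.
exists (block_mx (col_ebase K) 0 0 1%:M *m row_ebase K).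
  by rewrite unitmx_mul row_ebase_unit andbT unitmxE det_lblock det1 mulr1
    -unitmxE col_ebase_unit.
rewrite -mul_usub_mx /= block_mxEv col_mxKu -[RHS]mulmx_ebase rk.
by congr (_ *m _); rewrite pid_mx_row mul_mx_row mulmx1 mulmx0.
Qed.

Lemma card_unit_lblock k m (A : 'M[F]_k) : A \in unitmx ->
  #|[set h : 'M[F]_(k + m) | (h \in unitmx) && (usubmx h == row_mx A 0)]|
  = (q ^ (m * k) * gl_card m)%N.
Proof.
move=> UA; rewrite -(card_mx F m k) -cardsT -cardsX.
rewrite -(card_imset _ (f := fun p => block_mx A 0 p.1 p.2)); last first.
  by case=> C D [C' D'] /eq_block_mx[_ _ /= -> ->].
apply: eq_card=> h; apply/idP/imsetP=> [|[[C D]]].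
  rewrite inE => /andP[Uh /eqP Kh]; exists (dlsubmx h, drsubmx h).
    have hE : h = block_mx A 0 (dlsubmx h) (drsubmx h).
      by rewrite -[LHS]vsubmxK Kh -[dsubmx h]hsubmxK.
    move: Uh; rewrite hE !inE unitmxE det_lblock unitrM => /andP[_].
    by rewrite -unitmxE -hE.
  by rewrite -[LHS]vsubmxK Kh -[dsubmx h]hsubmxK.
rewrite !inE /= => UD ->.
by rewrite unitmxE det_lblock unitrM -!unitmxE UA UD block_mxEv col_mxKu eqxx.
Qed.

(** Right multiplication by one completion of K reduces to the case
    K = (1 0), where the completions are the invertible lower block triangular
    matrices with upper left block 1. *)
Lemma card_unit_usubmx k m (K : 'M[F]_(k, k + m)) : row_free K ->
  #|[set h : 'M[F]_(k + m) | (h \in unitmx) && (usubmx h == K)]|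
  = (q ^ (m * k) * gl_card m)%N.
Proof.
move=> /row_free_complete[h0 Uh0 <-].
rewrite -(@card_unit_lblock k m 1%:M) ?unitmx1 //.
rewrite -[RHS](card_imset _ (can_inj (mulmxK Uh0))).
apply: eq_card=> h; apply/idP/imsetP=> [|[g]].
  rewrite inE => /andP[Uh /eqP Kh]; exists (h *m invmx h0); last first.
    by rewrite mulmxKV.
  rewrite inE unitmx_mul Uh unitmx_inv Uh0 /= -mul_usub_mx Kh mul_usub_mx.
  by rewrite mulmxV // scalar_mx_block block_mxEv col_mxKu.
rewrite !inE => /andP[Ug /eqP Kg] ->; rewrite unitmx_mul Ug Uh0 -mul_usub_mx Kg.
by rewrite -[h0 in X in _ == X]mul1mx -mul_usub_mx scalar_mx_block block_mxEv
  col_mxKu eqxx.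
Qed.

End Completion.

Lemma row_companion_last (R : nzRingType) k (w : 'rV[R]_k.+1) :
  row ord_max (companion_of w) = w.
Proof. by apply/rowP=> j; rewrite !mxE eqxx. Qed.

Lemma row_companion_lt (R : nzRingType) k (w : 'rV[R]_k.+1) (i j : 'I_k.+1) :
  j = i.+1 :> nat -> row i (companion_of w) = delta_mx 0 j.
Proof.
move=> ji; have lt_ik : (i < k)%N by rewrite -ltnS -ji.
by apply/rowP=> l; rewrite !mxE eqxx ltn_eqF //= -ji eq_sym val_eqE.
Qed.

Lemma companion_of_inj (R : nzRingType) k : injective (@companion_of R k).
Proof. by move=> v w e;
  rewrite -(row_companion_last v) e row_companion_last. Qed.

(** The two descriptions of a basis of a cyclic subspace, adapted to x: x acts
    on U as a companion matrix, or U is a Krylov sequence that stops. *)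
Lemma companion_krylov (F : fieldType) n k (x : 'M[F]_n) (U : 'M_(k.+1, n)) v :
  (exists w, U *m x = companion_of w *m U) /\ row 0 U = v
  <-> U = krylov k.+1 x v /\ (v *m x ^+ k.+1 <= U)%MS.
Proof.
split=> [[[w Ux] U0] | [-> /submxP[w vw]]].
  have rowU (i : 'I_k.+1) : row i U = v *m x ^+ i.
    case: i => i; elim: i => [|i IHi] lt_ik.
      by rewrite mulmx1 -U0; congr (row _ U); apply: val_inj.
    have lt_ik' := ltnW lt_ik.
    rewrite exprSr mulmxA -(IHi lt_ik') -row_mul Ux row_mul.
    by rewrite (@row_companion_lt _ _ _ _ (Ordinal lt_ik)) // -rowE.
  split; first by apply/row_matrixP=> i; rewrite rowU row_krylov.
  rewrite exprSr mulmxA -(rowU ord_max) -row_mul Ux row_mul row_companion_last.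
  exact: submxMl.
split; last by rewrite row_krylov mulmx1.
exists w; apply/row_matrixP=> i;
  rewrite !row_mul row_krylov -(mulmxA v) -[_ *m x]exprSr.
have [lt_ik | ] := ltnP i k.
  by rewrite (@row_companion_lt _ _ _ _ (Ordinal (lt_ik : i.+1 < k.+1)%N)) //
    -rowE row_krylov.
rewrite leq_eqVlt ltnNge -ltnS ltn_ord orbF => /eqP ki.
have -> : i = ord_max by apply: val_inj; rewrite /= -ki.
by rewrite row_companion_last.
Qed.

Section Count.
Variables (F : finFieldType) (P : pred {poly F}).
Hypothesis PM : forall f g, f \is monic -> g \is monic ->
  P (f * g) = P f && P g.
Local Notation q := #|F|.

Definition card_char m := #|[set x : 'M[F]_m | P (char_poly x)]|.
Definition card_monic m := #|[set w : 'rV[F]_m | P (monic_of w)]|.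

(** In the basis given by the rows of h, the matrix x is lower block triangular
    with a companion matrix as its upper left block. *)
Definition cyclic_basis k m (x h : 'M[F]_(k.+1 + m)) : bool :=
  [exists w, usubmx h *m x == companion_of w *m usubmx h].

Lemma row_free_usubmx k m (h : 'M[F]_(k + m)) : h \in unitmx ->
  row_free (usubmx h).
Proof.
move=> Uh; apply/row_freeP; exists (lsubmx (invmx h)).
have e : col_mx (usubmx h) (dsubmx h)
    *m row_mx (lsubmx (invmx h)) (rsubmx (invmx h)) = 1%:M.
  by rewrite vsubmxK hsubmxK mulmxV.
by move: e; rewrite mul_col_row scalar_mx_block => /eq_block_mx[].
Qed.

(** An adapted basis h is found by choosing its first vector v, whose Krylov
    sequence then forces the first k + 1 rows, and completing them. *)
Lemma card_cyclic_basis k m (x : 'M[F]_(k.+1 + m)) :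
  #|[set h | (h \in unitmx) && cyclic_basis x h]|
  = ((\sum_(v : 'rV_(k.+1 + m)) (row_free (krylov k.+1 x v)
                 && (v *m x ^+ k.+1 <= krylov k.+1 x v)%MS))
    * (q ^ (m * k.+1) * gl_card F m))%N.
Proof.
rewrite -sum1_card (partition_big (fun h => row 0 (usubmx h)) predT) //=.
rewrite big_distrl /=; apply: eq_bigr => v _; rewrite sum1_card.
case: andP => [[free_v sub_v] | not_v]; last first.
  rewrite mul0n; apply: eq_card0 => h; rewrite [RHS]inE; apply/negP.
  rewrite unfold_in /= inE => /andP[/andP[Uh /existsP[w /eqP hw]] /eqP h0].
  have [|hK sub_v] := iffLR (@companion_krylov _ _ _ x (usubmx h) v).
    by split=> //; exists w.
  by apply: not_v; rewrite -hK row_free_usubmx.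
rewrite mul1n -(card_unit_usubmx free_v).
apply: eq_card => h; rewrite !inE unfold_in /= inE -andbA; congr (_ && _).
apply/andP/eqP => [[/existsP[w /eqP hw] /eqP h0] | hK].
  by case: (iffLR (@companion_krylov _ _ _ x (usubmx h) v)) => //;
    split=> //; exists w.
have [|[w hw] h0] := iffRL (@companion_krylov _ _ _ x (usubmx h) v).
  by rewrite hK.
by split; [apply/existsP; exists w; apply/eqP | apply/eqP].
Qed.

(** In the standard basis the matrices counted are the block matrices with a
    companion block, an arbitrary block below it and a diagonal block D; their
    characteristic polynomial is the product of those of the diagonal blocks. *)
Lemma card_cyclic_mx1 k m :
  #|[set x : 'M[F]_(k.+1 + m) | P (char_poly x) && cyclic_basis x 1%:M]|
  = (card_monic k.+1 * (q ^ (m * k.+1) * card_char m))%N.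
Proof.
rewrite -(card_mx F m k.+1) -cardsT -!cardsX.
pose f (p : 'rV[F]_k.+1 * ('M[F]_(m, k.+1) * 'M[F]_m)) :=
  block_mx (companion_of p.1) 0 p.2.1 p.2.2.
rewrite -(card_imset _ (f := f)); last first.
  by case=> w [C D] [w' [C' D']] /eq_block_mx[/companion_of_inj /= -> _ -> ->].
have u1 : usubmx 1%:M = row_mx 1%:M 0 :> 'M[F]_(k.+1, k.+1 + m).
  by rewrite scalar_mx_block block_mxEv col_mxKu.
apply: eq_card => x; apply/idP/imsetP=> [|[[w [C D]]]].
  rewrite inE /cyclic_basis u1 => /andP[Px /existsP[w /eqP]].
  rewrite mul_mx_row mulmx1 mulmx0 -[x in _ *m x]vsubmxK mul_row_col mul1mx
    mul0mx addr0.
  move=> xw; have xE : x = block_mx (companion_of w) 0 (dlsubmx x) (drsubmx x).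
    by rewrite -[LHS]vsubmxK xw -[dsubmx x]hsubmxK.
  exists (w, (dlsubmx x, drsubmx x)) => //; move: Px.
  by rewrite {1}xE char_poly_lblock PM ?char_poly_monic // char_companion_of
    !inE /=.
rewrite !inE /= => /andP[Pw PD] ->; rewrite /f /=.
rewrite char_poly_lblock PM ?char_poly_monic // char_companion_of Pw PD /=.
apply/existsP; exists w;
  rewrite u1 mul_mx_row mulmx1 mulmx0 mul_row_col mul1mx mul0mx.
by rewrite addr0.
Qed.

Lemma cyclic_basis_conj k m (x h : 'M[F]_(k.+1 + m)) : h \in unitmx ->
  cyclic_basis (h *m x *m invmx h) 1%:M = cyclic_basis x h.
Proof.
move=> Uh; apply: eq_existsb => w.
have -> : usubmx 1%:M = usubmx h *m invmx h.
  by rewrite mul_usub_mx mulmxV.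
rewrite -mulmxA -(mulmxA h) (mulKmx Uh) !mulmxA.
exact: (inj_eq (can_inj (mulmxKV Uh))).
Qed.

(** Conjugation by h reduces to the standard basis. *)
Lemma card_cyclic_mx k m (h : 'M[F]_(k.+1 + m)) : h \in unitmx ->
  #|[set x | P (char_poly x) && cyclic_basis x h]|
  = (card_monic k.+1 * (q ^ (m * k.+1) * card_char m))%N.
Proof.
move=> Uh; rewrite -card_cyclic_mx1.
have conjK : cancel (fun x => invmx h *m x *m h) (fun x => h *m x *m invmx h).
  by move=> x; rewrite !mulmxA mulmxV // mul1mx mulmxK.
have conjVK : cancel (fun x => h *m x *m invmx h) (fun x => invmx h *m x *m h).
  by move=> x; rewrite !mulmxA mulVmx // mul1mx mulmxKV.
rewrite -[LHS](card_imset _ (can_inj conjVK)); apply: eq_card => x.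
apply/imsetP/idP=> [[y] | ].
  by rewrite !inE => /andP[Py fy] ->;
    rewrite char_poly_conj // Py cyclic_basis_conj.
rewrite inE => /andP[Px fx]; exists (invmx h *m x *m h); last by rewrite conjK.
by rewrite inE -cyclic_basis_conj // conjK fx andbT -(char_poly_conj _ Uh)
  conjK.
Qed.

(** Double counting of the pairs (x, h) where h is a basis adapted to x: by x
    with [card_cyclic_basis], by h with [card_cyclic_mx].  The factor counting
    the blocks below the diagonal is the same on both sides. *)
Lemma card_krylov_char k m :
  ((\sum_(x : 'M[F]_(k.+1 + m) | P (char_poly x))
     \sum_(v : 'rV_(k.+1 + m)) (row_free (krylov k.+1 x v)
                 && (v *m x ^+ k.+1 <= krylov k.+1 x v)%MS)) * gl_card F m
  = gl_card F (k.+1 + m) * (card_monic k.+1 * card_char m))%N.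
Proof.
have q_gt0 : (0 < q ^ (m * k.+1))%N by rewrite expn_gt0 (cardD1 0).
apply/eqP; rewrite -(eqn_pmul2r q_gt0); apply/eqP.
transitivity (\sum_(x : 'M[F]_(k.+1 + m) | P (char_poly x))
   #|[set h | (h \in unitmx) && cyclic_basis x h]|)%N.
  rewrite -mulnA [(_ * q ^ _)%N]mulnC big_distrl; apply: eq_bigr => x _.
  by rewrite card_cyclic_basis.
under eq_bigr => x _ do rewrite -sum1_card.
rewrite (exchange_big_dep (fun h => h \in unitmx)) /=; last first.
  by move=> x h _; rewrite inE => /andP[].
rewrite -!mulnA [(card_char m * _)%N]mulnC /gl_card -[X in (X * _)%N]sum1_card
  big_distrl /=.
rewrite [RHS](eq_bigl (fun h : 'M_(_ + m) => h \in unitmx)) => [|h];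
  last by rewrite inE.
apply: eq_bigr => h Uh; rewrite mul1n -(card_cyclic_mx Uh) -sum1_card.
by apply: eq_bigl => x; rewrite !inE Uh.
Qed.

Lemma gl_card_gt0 m : (0 < gl_card F m)%N.
Proof. by apply/card_gt0P; exists 1%:M; rewrite inE unitmx1. Qed.

(** With a_n the proportion of [card_char P n] in the size of GL_n, this reads
    A(qz) = G(z) A(z): the pairs (x, v) with v nonzero, which number q^n - 1 for
    each x, are sorted by the dimension of the cyclic subspace of v. *)
Theorem card_char_rec n :
  (q%:R ^+ n - 1) * ((card_char n)%:R / (gl_card F n)%:R)
  = \sum_(k < n) (card_monic k.+1)%:R
       * ((card_char (n - k.+1))%:R / (gl_card F (n - k.+1))%:R) :> rat.
Proof.
have gl_neq0 m : (gl_card F m)%:R != 0 :> rat.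
  by rewrite Num.Theory.pnatr_eq0 -lt0n gl_card_gt0.
pose stop k (x : 'M[F]_n) (v : 'rV[F]_n) := row_free (krylov k x v)
                 && (v *m x ^+ k <= krylov k x v)%MS.
have stopE (k : 'I_n) : (card_monic k.+1)%:R
       * ((card_char (n - k.+1))%:R / (gl_card F (n - k.+1))%:R)
  = (\sum_(x | P (char_poly x)) \sum_v (stop k.+1 x v : nat))%:R
      / (gl_card F n)%:R :> rat.
  move: (k : nat) (ltn_ord k) @stop => {}k lt_kn.
  have := card_krylov_char k (n - k.+1); rewrite subnKC // => e stop.
  rewrite mulrA -natrM; apply/eqP; rewrite eqr_div // -!natrM; apply/eqP.
  by rewrite e mulnC.
under eq_bigr do rewrite stopE.
rewrite -mulr_suml mulrA; congr (_ / _).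
rewrite -natr_sum exchange_big /=.
under eq_bigr => x _.
  rewrite exchange_big /= (bigD1 0) //= big1 => [|k _]; last first.
    have -> : stop k.+1 x 0 = false; last by [].
    rewrite /stop; apply/negP=> /andP[/row_freeP[B]].
    have -> : krylov k.+1 x 0 = 0.
      by apply/row_matrixP=> i; rewrite row_krylov mul0mx row0.
    rewrite mul0mx => /(congr1 (fun A : 'M_k.+1 => A 0 0)) /eqP.
    by rewrite !mxE eq_sym oner_eq0.
  under eq_bigr => v v_neq0 do rewrite sum_krylov_stop //.
  over.
rewrite /= sum_nat_const add0n sum1_card cardC1 card_mx mul1n natrM mulrC.
have q_gt0 : (0 < q ^ n)%N by rewrite expn_gt0; apply/orP; left;
  apply/card_gt0P; exists 0.
rewrite -subn1 natrB // natrX; congr (_%:R * _).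
by apply: eq_card=> x; rewrite inE.
Qed.
End Count.

(** * Irreducible factors and the count of monic polynomials *)

Section Irreducible.
Variable F : finFieldType.
Implicit Types f g h S T phi : {poly F}.

Lemma irredp_dvd f : (1 < size f)%N ->
  exists phi, [/\ irreducible_poly phi, phi \is monic & phi %| f].
Proof.
have [n] := ubnP (size f); elim: n f => // n IHn f lt_fn f_gt1.
have f_neq0 : f != 0 by rewrite -size_poly_gt0 ltnW.
case: (boolP (irreducibleb f)) => [/irreducibleP irr_f | ].
  exists ((lead_coef f)^-1 *: f); have lf : (lead_coef f)^-1 != 0.
    by rewrite invr_eq0 lead_coef_eq0.
  split; first split.
  - by rewrite size_scale.
  - move=> g g1; rewrite dvdpZr // => /(irr_f.2 _ g1) /eqp_trans; apply.
    by rewrite eqp_sym eqp_scale.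
  - by rewrite monicE lead_coefZ mulVf // lead_coef_eq0.
  - by rewrite dvdpZl.
rewrite /irreducibleb f_gt1 negb_forall => /existsP[g].
rewrite negb_imply -ltnNge -Pdiv.Idomain.dvdpE => /andP[gf g_gt1].
have [|phi [irr_phi mon_phi phig]] := IHn g _ g_gt1; last first.
  by exists phi; split=> //; apply: dvdp_trans gf.
apply: leq_ltn_trans (size_npoly g) _.
by rewrite -ltnS prednK // ltnW.
Qed.

Lemma irredp_prime phi f g : irreducible_poly phi ->
  (phi %| f * g) = (phi %| f) || (phi %| g).
Proof.
move=> irr_phi; case: (boolP (phi %| f)) => [phif | nphif] /=.
  exact: dvdp_mulr.
by rewrite Gauss_dvdpr // irreducible_poly_coprime.
Qed.

Lemma irredp_dvd_exp phi f n : irreducible_poly phi -> phi %| f ^+ n ->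
  phi %| f.
Proof.
move=> irr_phi; elim: n => [|n IHn];
  last by rewrite exprS irredp_prime // => /orP[].
by rewrite expr0 dvdp1 => /eqP size1; have := irr_phi.1; rewrite size1.
Qed.

(** Peel off irreducible factors: each contributes at least 1 to the degree and
    divides one factor T. *)
Lemma irredp_dvd_all f T : f != 0 ->
  (forall phi, irreducible_poly phi -> phi \is monic -> phi %| f -> phi %| T) ->
  f %| T ^+ (size f).-1.
Proof.
have [n] := ubnP (size f); elim: n f => // n IHn f lt_fn f_neq0 fT.
have [f_gt1 | f_le1] := ltnP 1 (size f); last first.
  apply: dvdp_trans (dvd1p _); rewrite dvdp1 eqn_leq f_le1.
  by rewrite size_poly_gt0.
have [phi [irr_phi mon_phi /dvdpP[g fE]]] := irredp_dvd f_gt1.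
have [g_neq0 phi_neq0] : g != 0 /\ phi != 0.
  by apply/andP; rewrite -negb_or -mulf_eq0 -fE.
have phi_gt1 := irr_phi.1.
have sizef : size f = (size g + (size phi).-1)%N.
  by rewrite fE size_mul // -[size phi in LHS](prednK (ltnW phi_gt1)) addnS.
have phi1 : (0 < (size phi).-1)%N by rewrite -subn1 subn_gt0.
have g_gt0 : (0 < size g)%N by rewrite size_poly_gt0.
apply: dvdp_trans (_ : T ^+ ((size g).-1).+1 %| _); last first.
  by rewrite dvdp_exp2l // sizef prednK // -subn1 -addnBA // leq_addr.
rewrite exprSr fE dvdp_mul //; last by apply: fT; rewrite // fE dvdp_mull.
apply: IHn => // [|psi irr_psi mon_psi psig].
  by rewrite -ltnS (leq_trans _ lt_fn) // ltnS sizef -addn1 leq_add2l.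
by apply: fT; rewrite // fE dvdp_mulr.
Qed.

(** The product of the distinct irreducible factors of f divides S; the
    exponent only has to be at least every multiplicity in f. *)
Definition radical_divides S f := f %| S ^+ (size f).-1.

Lemma radical_dividesP S f : f != 0 ->
  reflect (forall phi, irreducible_poly phi -> phi \is monic ->
             phi %| f -> phi %| S)
          (radical_divides S f).
Proof.
move=> f_neq0; apply: (iffP idP) => [fS phi irr_phi _ phif|].
  by apply: irredp_dvd_exp irr_phi (dvdp_trans phif fS).
exact: irredp_dvd_all.
Qed.

Lemma radical_dividesM S f g : f \is monic -> g \is monic ->
  radical_divides S (f * g) = radical_divides S f && radical_divides S g.
Proof.
move=> /monic_neq0 f0 /monic_neq0 g0;
  have fg0 : f * g != 0 by rewrite mulf_neq0.
apply/(radical_dividesP _ fg0)/andP =>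
  [fgS | [/(radical_dividesP _ f0) fS] /(radical_dividesP _ g0) gS].
  split; apply/radical_dividesP=> // phi irr mon phid; apply: fgS => //.
    exact: dvdp_mulr.
  exact: dvdp_mull.
by move=> phi irr mon; rewrite irredp_prime // => /orP[/fS|/gS]; apply.
Qed.

Lemma irredp_eqp phi psi : irreducible_poly phi -> irreducible_poly psi ->
  phi \is monic -> psi \is monic -> phi %| psi -> phi = psi.
Proof.
move=> irr_phi irr_psi mon_phi mon_psi dvd; apply/eqP; rewrite -eqp_monic //.
by apply: irr_psi.2 => //; rewrite gtn_eqF // irr_phi.1.
Qed.

(** The multiplicity of phi in f is the number of powers of phi with positive
    exponent that divide f; counting it this way makes the double counting in
    [card_monic_rec] linear. *)
Lemma degree_irredp (s : seq {poly F}) N f : uniq s -> f != 0 ->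
  {in s, forall phi, irreducible_poly phi /\ phi \is monic} ->
  (forall phi, irreducible_poly phi -> phi \is monic -> phi %| f -> phi \in s)
    ->
  ((size f).-1 <= N)%N ->
  (size f).-1 = (\sum_(phi <- s) (size phi).-1 * \sum_(j < N) (phi ^+ j.+1 %|
    f)%R)%N.
Proof.
move=> s_uniq + s_irr; have [n] := ubnP (size f).
elim: n f N => // n IHn f N lt_fn f_neq0 fs le_fN.
have [f_gt1 | f_le1] := ltnP 1 (size f); last first.
  have -> : (size f).-1 = 0%N by rewrite -subn1; apply/eqP; rewrite subn_eq0.
  rewrite big1_seq // => phi /andP[_ /s_irr[irr_phi _]].
  rewrite big1 ?muln0 // => j _; apply/eqP; rewrite eqb0.
  apply/negP=> /(dvdp_leq f_neq0) le1; have := irr_phi.1.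
  rewrite ltnNge (leq_trans _ f_le1) // (leq_trans _ le1) //.
  by rewrite dvdp_leq // ?expf_neq0 ?irredp_neq0 // exprS dvdp_mulr.
have [phi [irr_phi mon_phi phif]] := irredp_dvd f_gt1.
have phi_s := fs _ irr_phi mon_phi phif.
have /dvdpP[g fE] := phif.
have [g_neq0 phi_neq0] : g != 0 /\ phi != 0.
  by apply/andP; rewrite -negb_or -mulf_eq0 -fE.
have phi_gt1 := irr_phi.1.
have sizef : size f = (size g + (size phi).-1)%N.
  by rewrite fE size_mul // -[size phi in LHS](prednK (ltnW phi_gt1)) addnS.
have phi1 : (0 < (size phi).-1)%N by rewrite -subn1 subn_gt0.
have g_gt0 : (0 < size g)%N by rewrite size_poly_gt0.
have degf : (size f).-1 = ((size g).-1 + (size phi).-1)%N.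
  by rewrite sizef -!subn1 addnBAC.
case: N le_fN => [|N]; first by rewrite degf -(prednK phi1) addnS.
move=> le_fN; have le_gN : ((size g).-1 <= N)%N.
  by rewrite -ltnS (leq_trans _ le_fN) // degf -addn1 leq_add2l.
have IH : (size g).-1 = (\sum_(psi <- s) (size psi).-1 * \sum_(j < N) (psi ^+
  j.+1 %| g)%R)%N.
  apply: IHn => //; first by rewrite -ltnS (leq_trans _ lt_fn) // ltnS sizef
    -addn1 leq_add2l.
  by move=> psi irr_psi mon_psi psig; apply: fs; rewrite // fE dvdp_mulr.
rewrite degf {}IH !(bigD1_seq phi) //= addnAC; congr (_ + _)%N.
  rewrite big_ord_recl expr1 phif /= mulnDr muln1 addnC; congr (_ + _ * _)%N.
  by apply: eq_bigr => j _;
    rewrite /bump /= add1n fE (exprSr _ j.+1) dvdp_mul2r.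
rewrite [LHS]big_seq_cond [RHS]big_seq_cond;
  apply: eq_bigr => psi /andP[psi_s psi_phi].
have [irr_psi mon_psi] := s_irr _ psi_s.
have co : coprimep psi phi.
  rewrite irreducible_poly_coprime //; apply: contra psi_phi => dvd.
  exact/eqP/irredp_eqp.
congr (_ * _)%N; rewrite big_ord_recr /= [X in (_ + X)%N](_ : _ = 0%N);
  last first.
  apply/eqP; rewrite eqb0; rewrite fE Gauss_dvdpl ?coprimep_expl //.
  apply/negP=> /(dvdp_leq g_neq0); rewrite leqNgt => /negP; apply.
  have [lt1 sz] := (irr_psi.1, size_exp psi N.+1).
  rewrite -(prednK (_ : 0 < size (psi ^+ N.+1))%N) ?sz; last first.
    by rewrite size_poly_gt0 expf_neq0 ?irredp_neq0.
  apply: (@leq_trans N.+2); last first.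
    by rewrite ltnS -[X in (X <= _)%N]mul1n leq_mul2r -ltnS prednK // ltnW.
  by rewrite -(prednK g_gt0) ltnS.
rewrite addn0; apply: eq_bigr => j _.
by rewrite fE Gauss_dvdpl // coprimep_expl.
Qed.

End Irreducible.

Lemma monic_of_inj (R : nzRingType) k : injective (@monic_of R k).
Proof. by move=> v w /addrI/oppr_inj/(congr1 (poly_rV (d := k)));
  rewrite !rVpolyK. Qed.

Lemma monic_ofP (R : nzRingType) k (f : {poly R}) : f \is monic ->
  size f = k.+1 ->
  exists w : 'rV_k, monic_of w = f.
Proof.
move=> mon_f szf; exists (poly_rV ('X^k - f)).
rewrite /monic_of poly_rV_K ?subKr //; apply/leq_sizeP=> j.
rewrite leq_eqVlt coefB coefXn => /orP[/eqP <- | lt_kj].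
  by move: mon_f; rewrite eqxx monicE lead_coefE szf => /eqP ->; rewrite subrr.
by rewrite gtn_eqF // nth_default ?subrr // szf.
Qed.

Section Recurrence.
Variable F : finFieldType.
Implicit Types (phi psi f S : {poly F}).

(** Division by psi is a bijection, and multiplicativity transports P. *)
Lemma card_monic_dvd (P : pred {poly F}) psi n D :
  (forall f g, f \is monic -> g \is monic -> P (f * g) = P f && P g) ->
  P psi -> psi \is monic -> size psi = D.+1 -> (D <= n)%N ->
  #|[set w : 'rV[F]_n | P (monic_of w) && (psi %| monic_of w)]|
  = card_monic P (n - D).
Proof.
move=> PM Ppsi mon_psi szpsi le_Dn.
pose W (w : 'rV[F]_(n - D)) : 'rV[F]_n := poly_rV ('X^n - psi * monic_of w).
have WE w : monic_of (W w) = psi * monic_of w.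
  have [||v vE] := @monic_ofP _ n (psi * monic_of w).
  - by rewrite monicMl // monic_of_monic.
  - by rewrite size_monicM ?monic_neq0 ?monic_of_monic // szpsi size_monic_of
    addnS /= addSn subnKC.
  by rewrite /W -vE /monic_of subKr rVpolyK.
have W_inj : injective W.
  move=> v w /(congr1 (@monic_of F n));
    rewrite !WE => /(mulfI (monic_neq0 mon_psi)).
  exact: monic_of_inj.
rewrite -[RHS](card_imset _ W_inj); apply: eq_card => v;
  apply/idP/imsetP=> [|[w]].
  rewrite inE => /andP[Pv /dvdpP[g vE]].
  have mon_g : g \is monic by rewrite -(monicMr _ mon_psi) -vE monic_of_monic.
  have szg : size g = (n - D).+1.
    have := size_monic_of v; rewrite vE size_monicM ?monic_neq0 //.
    rewrite szpsi addnS /= => /eqP; rewrite -(eqn_add2r D) => /eqP szg.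
    apply/eqP; rewrite -(eqn_add2r D) addSn subnK // -(eqn_add2r D); exact/eqP.
  have [w wE] := monic_ofP mon_g szg; exists w; last first.
    by apply: monic_of_inj; rewrite WE wE vE mulrC.
  by move: Pv; rewrite vE PM // inE wE => /andP[].
rewrite !inE => Pw ->; rewrite WE PM ?monic_of_monic // Ppsi Pw.
by rewrite dvdp_mulr.
Qed.

Definition irr_factors S : seq {poly F} :=
  [seq phi <- [seq val p | p : {poly_(size S) F}]
     | [&& irreducibleb phi, phi \is monic & phi %| S]].

Lemma irr_factors_uniq S : uniq (irr_factors S).
Proof. by rewrite filter_uniq // map_inj_uniq ?enum_uniq //;
  exact: val_inj. Qed.

Lemma mem_irr_factorsP S phi : S != 0 ->
  reflect [/\ irreducible_poly phi, phi \is monic & phi %| S]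
          (phi \in irr_factors S).
Proof.
move=> S_neq0; rewrite mem_filter;
  apply: (iffP andP) => [[/and3P[/irreducibleP]] | []] //.
move=> /irreducibleP irr mon dvd; split; first exact/and3P.
have le : (size phi <= size S)%N by apply: dvdp_leq.
by apply/mapP; exists (NPoly le); rewrite ?mem_enum.
Qed.

Lemma sum_multiples (G : nat -> nat) d n : (0 < d)%N ->
  (\sum_(j < n | j.+1 * d <= n) G (j.+1 * d)
   = \sum_(k < n | d %| k.+1) G k.+1)%N.
Proof.
move=> d_gt0.
transitivity (\sum_(j < n) \sum_(k < n) if j.+1 * d == k.+1 then G k.+1 else
  0)%N.
  rewrite big_mkcond; apply: eq_bigr => j _; rewrite -big_mkcond /=.
  case: leqP => [le_jn | lt_nj].
    have jd : (j.+1 * d).-1.+1 = (j.+1 * d)%N by rewrite prednK // muln_gt0.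
    have lt_jn : ((j.+1 * d).-1 < n)%N by rewrite jd.
    rewrite (big_pred1 (Ordinal lt_jn)) => [|k]; first by rewrite /= jd.
    by rewrite /= -val_eqE /= -[RHS]eqSS jd eq_sym.
  rewrite big_pred0 // => k; apply/eqP=> e; move: (ltn_ord k).
  by rewrite -e leqNgt lt_nj.
rewrite exchange_big [RHS]big_mkcond; apply: eq_bigr => k _ /=.
rewrite -big_mkcond /=; case: (boolP (d %| k.+1)%N) => [/dvdnP[j jE] | ndvd].
  have j_gt0 : (0 < j)%N by move: jE; case: j.
  have lt_jn : (j.-1 < n)%N.
    by rewrite prednK // (leq_trans (leq_pmulr j d_gt0)) // -jE.
  rewrite (big_pred1 (Ordinal lt_jn)) // => i.
  by rewrite /= -val_eqE /= jE eqn_pmul2r // -[j in LHS]prednK.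
rewrite big_pred0 // => j; apply: contraNF ndvd => /eqP <-.
exact: dvdn_mull.
Qed.

(** The identity z G' = E G: write the degree of each f as a sum over the prime
    powers phi^j dividing f ([degree_irredp]), exchange the sums, and count the
    multiples of phi^j with [card_monic_dvd]. *)
Theorem card_monic_rec S n : S != 0 ->
  (n * card_monic (radical_divides S) n
   = \sum_(k < n) (\sum_(phi <- irr_factors S | (size phi).-1 %| k.+1) (size
     phi).-1)
       * card_monic (radical_divides S) (n - k.+1))%N.
Proof.
move=> S_neq0; set P := radical_divides S; set s := irr_factors S.
have sP phi : phi \in s -> [/\ irreducible_poly phi, phi \is monic & phi %| S].
  by move/(mem_irr_factorsP _ S_neq0).
rewrite mulnC -sum_nat_const.
transitivity (\sum_(w in [set w : 'rV[F]_n | P (monic_of w)])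
   \sum_(phi <- s) (size phi).-1 * \sum_(j < n) (phi ^+ j.+1 %| monic_of
     w)%R)%N.
  apply: eq_bigr => w; rewrite inE => Pw.
  have mon_w := monic_of_monic w; have w_neq0 := monic_neq0 mon_w.
  rewrite -(@degree_irredp _ s n) ?size_monic_of ?irr_factors_uniq //.
    by move=> phi /sP[].
  move=> phi irr mon dvd; apply/(mem_irr_factorsP _ S_neq0); split=> //.
  by have /(radical_dividesP _ w_neq0) := Pw; apply.
rewrite exchange_big /=.
transitivity (\sum_(phi <- s) \sum_(k < n | (size phi).-1 %| k.+1)
   ((size phi).-1 * card_monic P (n - k.+1)))%N; last first.
  under [RHS]eq_bigr do rewrite big_distrl big_mkcond.
  rewrite [RHS]exchange_big; apply: eq_bigr => phi _.
  by rewrite [LHS]big_mkcond.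
apply: eq_big_seq => phi /sP[irr mon dvd].
rewrite -!big_distrr /=; congr (_ * _)%N.
have d_gt0 : (0 < (size phi).-1)%N by rewrite -subn1 subn_gt0 irr.1.
rewrite -(@sum_multiples (fun m => card_monic P (n - m)) _ n d_gt0).
rewrite exchange_big [RHS]big_mkcond /=; apply: eq_bigr => j _.
have szj : size (phi ^+ j.+1) = (j.+1 * (size phi).-1).+1.
  by rewrite mulnC -size_exp prednK // size_poly_gt0 expf_neq0 ?irredp_neq0.
rewrite -big_mkcondr sum1_card; case: leqP => [le_jn | lt_nj].
  rewrite -(@card_monic_dvd P (phi ^+ j.+1)) ?monic_exp //; last 2 first.
  - exact: radical_dividesM.
  - rewrite /P /radical_divides szj /=.
    rewrite (dvdp_trans (dvdp_exp2r _ dvd)) // dvdp_exp2l // -[X in (X <=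
      _)%N]muln1.
    by rewrite leq_mul2l d_gt0.
  by apply: eq_card => w; rewrite !inE unfold_in /= inE.
apply: eq_card0 => w; rewrite !inE unfold_in /= inE; apply/negP=> /andP[_].
move=> /(dvdp_leq (monic_neq0 (monic_of_monic w))).
by rewrite szj size_monic_of ltnS leqNgt lt_nj.
Qed.
End Recurrence.

(** * Degrees of the irreducible factors of cyclic polynomials *)

(** The residue field F[X]/phi, presented by its quotient map. *)
Lemma irredp_residue_field (F : finFieldType) (phi : {poly F}) :
  irreducible_poly phi -> phi \is monic ->
  exists (L : finFieldType) (iota : {rmorphism {poly F} -> L}),
   [/\ #|L| = (#|F| ^ (size phi).-1)%N,
       forall f, (iota f == 0) = (phi %| f)
     & forall y, exists f, iota f = y].
Proof.
move=> irr mon; pose mi : monic_irreducible_poly phi := (irr, mon).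
exists ({poly %/ phi with mi} : finFieldType).
exists (in_qpoly phi : {rmorphism _ -> {poly %/ phi}}); split.
- exact: card_qfpoly.
- move=> f; rewrite -val_eqE /= mk_monicE //.
by rewrite Pdiv.Idomain.dvdpE.
move=> y; pose z : {poly %/ phi} := y; exists (val z).
have zE : in_qpoly phi (val z) = z.
  by apply: val_inj; apply: in_qpoly_small; apply: size_mk_monic.
exact: zE.
Qed.

Lemma pnat_card_finField (F : finFieldType) :
  exists2 p, p \in [pchar F] & p.-nat #|F|.
Proof.
have [p p_pr chp] := finPcharP F; exists p => //.
by have := pprimeChar_pgroup chp; rewrite /pgroup cardsT.
Qed.


Lemma dvdp_Xn_sub_1 (R : idomainType) m n : (m %| n)%N ->
  ('X^m - 1 : {poly R}) %| 'X^n - 1.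
Proof. by case/dvdnP=> k ->;
  rewrite mulnC exprM -[1 in X in _ %| X](expr1n _ k) subrXX dvdp_mulr. Qed.

Lemma dvdp_Xn_sub_1_gcd (R : idomainType) (phi : {poly R}) m n :
  (0 < m)%N -> ~~ (phi %| 'X) -> irreducible_poly phi ->
  (phi %| 'X^m - 1) -> (phi %| 'X^n - 1) -> phi %| 'X^(gcdn m n) - 1.
Proof.
move=> m_gt0 nphiX irr phim phin.
case: (egcdnP n m_gt0) => u v uv _; rewrite gcdnC in uv.
have : phi %| 'X^(v * n + gcdn m n) - 1.
  by rewrite gcdnC -uv (dvdp_trans phim) // dvdp_Xn_sub_1 // dvdn_mull.
have -> : 'X^(v * n + gcdn m n) - 1
    = 'X^(gcdn m n) * ('X^(v * n) - 1) + ('X^(gcdn m n) - 1) :> {poly R}.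
  by rewrite exprD mulrBr mulr1 addrA subrK mulrC.
by rewrite dvdp_addr // dvdp_mull // (dvdp_trans phin) // dvdp_Xn_sub_1 //
  dvdn_mull.
Qed.

Section Degree.
Variables (F : finFieldType) (phi : {poly F}).
Hypotheses (irr : irreducible_poly phi) (mon : phi \is monic).
Local Notation q := #|F|.
Local Notation d := (size phi).-1.

(** In the residue field L of phi, of cardinality q^d, the class of X generates
    L over F, so it is fixed by the k-th power of the Frobenius map only if all
    of L is.  Then L is also fixed by the g-th power for g = gcd(k, d), and
    X^(q^g) - X has at least q^d roots, so d <= g. *)
Lemma irredp_dvd_XqX k : (0 < k)%N ->
  (phi %| 'X^(q ^ k) - 'X) = (d %| k)%N.
Proof.
move=> k_gt0; have [L [iota [cardL iota0 iota_surj]]] :=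
  irredp_residue_field irr mon.
have d_gt0 : (0 < d)%N by rewrite -subn1 subn_gt0 irr.1.
have q_gt1 : (1 < q)%N := finNzRing_gt1 F.
have frobL (y : L) j : y ^+ (q ^ (j * d)) = y.
  elim: j => [|j IHj]; first by rewrite mul0n expr1.
  by rewrite mulSn expnD exprM -cardL expf_card.
rewrite -iota0 rmorphB rmorphXn subr_eq0 /=.
apply/eqP/idP => [frobX | /dvdnP[j ->]]; last exact: frobL.
have [p chp p_q] := pnat_card_finField L.
have pq : [pchar L].-nat q.
  rewrite (eq_pnat _ (pcharf_eq chp)).
  by move: p_q; rewrite cardL pnatX eqn0Ngt d_gt0 orbF.
have frobk (y : L) : y ^+ (q ^ k) = y.
  have [f <-] := iota_surj y; elim/poly_ind: f => [|f c IHf].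
    by rewrite rmorph0 expr0n eqn0Ngt expn_gt0 ltnW.
  rewrite rmorphD rmorphM /= exprDn_pchar ?pnatX ?pq // exprMn IHf frobX.
  congr (_ + _); rewrite -rmorphXn -polyC_exp.
  congr (iota _%:P); elim: (k) => // j IHj.
  by rewrite expnS exprM expf_card IHj.
have frobkj (y : L) j : y ^+ (q ^ (j * k)) = y.
  elim: j => [|j IHj]; first by rewrite mul0n expr1.
  by rewrite mulSn expnD exprM frobk.
pose g := gcdn k d; have g_gt0 : (0 < g)%N by rewrite gcdn_gt0 k_gt0.
have frobg (y : L) : y ^+ (q ^ g) = y.
  case: (egcdnP d k_gt0) => u v uv _.
  by rewrite -[RHS](frobkj y u) uv expnD exprM frobL.
suffices le_dg : (d <= g)%N.
  rewrite -(_ : g = d) ?dvdn_gcdl //; apply/eqP; rewrite eqn_leq le_dg andbT.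
  by rewrite dvdn_leq // dvdn_gcdr.
have qg_gt1 : (1 < q ^ g)%N by rewrite -(exp1n g) ltn_exp2r.
have szP : size ('X^(q ^ g) - 'X : {poly L}) = (q ^ g).+1.
  by rewrite size_polyDl size_polyXn // size_polyN size_polyX ltnS.
have P_neq0 : 'X^(q ^ g) - 'X != 0 :> {poly L} by rewrite -size_poly_eq0 szP.
have := max_poly_roots P_neq0 (rs := enum L).
rewrite szP enum_uniq ltnS -cardE cardL leq_exp2l //; apply=> //.
by apply/allP=> y _; rewrite rootE !hornerE frobg subrr.
Qed.

Lemma irredp_dvd_Xq1 k : (0 < k)%N -> ~~ (phi %| 'X) ->
  (phi %| 'X^((q ^ k).-1) - 1) = (d %| k)%N.
Proof.
move=> k_gt0 nphiX; rewrite -irredp_dvd_XqX //.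
have -> : 'X^(q ^ k) - 'X = 'X * ('X^((q ^ k).-1) - 1) :> {poly F}.
  by rewrite mulrBr mulr1 -exprS prednK // expn_gt0 ltnW // finNzRing_gt1.
by rewrite irredp_prime // (negPf nphiX).
Qed.

End Degree.

Lemma irredp_ndvdX (F : fieldType) (phi : {poly F}) r : (0 < r)%N ->
  irreducible_poly phi -> phi %| 'X^r - 1 -> ~~ (phi %| 'X).
Proof.
move=> r_gt0 irr phir; apply/negP=> phiX; have := irr.1.
have : phi %| 'X^r by rewrite -(prednK r_gt0) exprS dvdp_mulr.
by rewrite -(subrK 1 'X^r) dvdp_addr // dvdp1 => /eqP ->.
Qed.

Lemma natr_coprime_card (F : finFieldType) r : coprime r #|F| -> r%:R != 0 :> F.
Proof.
move=> co_rq; have [p chp p_q] := pnat_card_finField F.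
have q_gt1 := finNzRing_gt1 F.
rewrite -(dvdn_pcharf chp); apply/negP=> p_r.
have pq : pdiv #|F| = p.
  by apply/eqP; have /pnatP := p_q; apply;
    rewrite ?pdiv_prime ?pdiv_dvd // ltnW.
have : (p %| gcdn r #|F|)%N by rewrite dvdn_gcd p_r -pq pdiv_dvd.
by rewrite (eqP co_rq) dvdn1 => /eqP p1; have := pcharf_prime chp; rewrite p1.
Qed.

(** The irreducible factors of X^r - 1 of degree dividing k are the common
    factors of X^r - 1 and X^(q^k - 1) - 1, that is the factors of X^e - 1 with
    e = gcd(r, q^k - 1).  This polynomial is separable, so their degrees add up
    to e. *)
Theorem sum_degree_irr_factors (F : finFieldType) r k :
  coprime r #|F| -> (0 < r)%N -> (0 < k)%N ->
  (\sum_(phi <- irr_factors ('X^r - 1 : {poly F}) | (size phi).-1 %| k)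
     (size phi).-1 = gcdn r (#|F| ^ k).-1)%N.
Proof.
move=> co_rq r_gt0 k_gt0; set S := 'X^r - 1; set e := gcdn r _.
have e_gt0 : (0 < e)%N by rewrite gcdn_gt0 r_gt0.
have unity_neq0 m : (0 < m)%N -> 'X^m - 1 != 0 :> {poly F}.
  by move=> m_gt0; rewrite -size_poly_eq0 size_XnsubC.
have e_neq0 : e%:R != 0 :> F by rewrite natr_coprime_card // (coprime_dvdl
  (dvdn_gcdl _ _)).
have sepT := separable_Xn_sub_1 e_neq0.
have -> : e = (size ('X^e - 1 : {poly F})).-1 by rewrite size_XnsubC.
rewrite (@degree_irredp _ (irr_factors S) e) ?irr_factors_uniq ?unity_neq0 //;
  first last.
- by rewrite size_XnsubC.
- move=> phi irr mon phie; apply/mem_irr_factorsP; rewrite ?unity_neq0 //.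
  by split=> //; rewrite (dvdp_trans phie) // dvdp_Xn_sub_1 // dvdn_gcdl.
- by move=> phi /mem_irr_factorsP; case; rewrite ?unity_neq0.
rewrite big_mkcond; apply: eq_big_seq => phi.
move/(mem_irr_factorsP _ (unity_neq0 _ r_gt0)) => [irr mon phir].
have nphiX := irredp_ndvdX r_gt0 irr phir.
rewrite -(irredp_dvd_Xq1 irr mon k_gt0 nphiX).
have -> : (phi %| 'X^((#|F| ^ k).-1) - 1) = (phi %| 'X^e - 1).
  apply/idP/idP=> [phik | phie]; first exact: dvdp_Xn_sub_1_gcd.
  by rewrite (dvdp_trans phie) // dvdp_Xn_sub_1 // dvdn_gcdr.
have -> : (\sum_(j < e) (phi ^+ j.+1 %| 'X^e - 1)%R = (phi %| 'X^e - 1)%R)%N.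
  move: ('X^e - 1) sepT => T sepT; case: (e) e_gt0 => // n _;
    rewrite big_ord_recl expr1 big1 ?addn0 // => j _.
  by rewrite separable_nosquare // gtn_eqF // irr.1.
by case: (phi %| _); rewrite ?muln1 ?muln0.
Qed.

(** * Characteristic polynomials of M-th powers *)

(** If f(A) = 0 then X - A divides the scalar matrix f(X) over F[X]; take
    determinants. *)
Lemma char_poly_dvd_exp (F : fieldType) n (A : 'M[F]_n.+1) f :
  horner_mx A f = 0 -> char_poly A %| f ^+ n.+1.
Proof.
move=> fA; have [phi [[psi phiK psiK] phiZ phiC _]] := mx_poly_ring_isom F n.
have : root (map_poly scalar_mx f) A by apply/rootP.
case/factor_theorem=> B fB.
have : f%:M = psi B *m char_poly_mx A.
  apply: (can_inj phiK); rewrite phiZ fB [RHS]rmorphM psiK; congr (_ * _).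
  by rewrite rmorphB phiC phiZ map_polyX.
by move/(congr1 determinant); rewrite det_scalar det_mulmx => ->;
  apply: dvdp_mull.
Qed.

(** The multiplicative group of L is cyclic. *)
Lemma finField_root (L : finFieldType) M (x : L) : (M %| #|L|.-1)%N ->
  x ^+ (#|L|.-1 %/ M) = 1 -> exists y, y ^+ M = x.
Proof.
move=> M_dvd xe; have q_gt1 := finNzRing_gt1 L.
have m_gt0 : (0 < #|L|.-1)%N by rewrite -subn1 subn_gt0.
have e_gt0 : (0 < #|L|.-1 %/ M)%N.
  by rewrite divn_gt0 ?(dvdn_gt0 _ M_dvd) // dvdn_leq.
have Ux : x \is a GRing.unit.
  by rewrite -(unitrX_pos _ e_gt0) xe unitr1.
pose u : {unit L} := FinRing.unit L Ux.
have /cyclicP[z zE] := field_unit_group_cyclic [set: {unit L}]%G.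
have ordz : #[z]%g = #|L|.-1 by rewrite orderE -zE card_finField_unit.
have /cycleP[i ui] : u \in <[z]>%g by rewrite -zE inE.
have : (z ^+ (i * (#|L|.-1 %/ M)) == 1)%g.
  by rewrite expgM -ui; apply/eqP/val_inj; rewrite FinRing.val_unitX.
rewrite -order_dvdn ordz -[X in (X %| _)%N](divnK M_dvd) mulnC dvdn_pmul2r //.
case/dvdnP=> j ij; exists (val (z ^+ j)%g).
rewrite -FinRing.val_unitX -expgM -ij -ui //.
Qed.

(** Chinese remainder theorem: roots modulo the irreducible factors of f are
    glued by Bezout coefficients. *)
Lemma root_mod_separable (F : finFieldType) M (f : {poly F}) :
  separable_poly f ->
  (forall phi, irreducible_poly phi -> phi \is monic -> phi %| f ->
     exists g, phi %| g ^+ M - 'X) ->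
  exists g, f %| g ^+ M - 'X.
Proof.
have [n] := ubnP (size f); elim: n f => // n IHn f lt_fn sepf fM.
have f_neq0 : f != 0 by apply: separable_poly_neq0.
have [f_gt1 | f_le1] := ltnP 1 (size f); last first.
  exists 0; apply: dvdp_trans (dvd1p _); rewrite dvdp1 eqn_leq f_le1.
  by rewrite size_poly_gt0.
have [phi [irr mon /dvdpP[h fE]]] := irredp_dvd f_gt1.
have [h_neq0 phi_neq0] : h != 0 /\ phi != 0.
  by apply/andP; rewrite -negb_or -mulf_eq0 -fE.
move: sepf; rewrite fE separable_mul => /and3P[seph _ co].
have [|//|psi irr' mon' psih|g1 hg1] := IHn h.
- rewrite -ltnS (leq_trans _ lt_fn) // ltnS fE size_mul //.
  by rewrite -(prednK (ltnW irr.1)) addnS /= -[X in (X < _)%N]addn0 ltn_add2l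
    -subn1 subn_gt0 irr.1.
- by apply: fM; rewrite // fE dvdp_mulr.
have [|g2 phig2] := fM _ irr mon; first by rewrite fE dvdp_mull.
have /Bezout_eq1_coprimepP[[u v] /= uv] := co.
exists (g1 * (v * phi) + g2 * (u * h)).
have congM (p a c : {poly F}) : p %| a - c -> p %| c ^+ M - 'X -> p %| a ^+ M -
  'X.
  move=> pac pc; rewrite -(subrK (c ^+ M) (a ^+ M)) -addrA dvdp_add //.
  by rewrite subrXX dvdp_mulr.
rewrite Gauss_dvdp //; apply/andP; split.
  apply: congM hg1; apply/dvdpP; exists ((g2 - g1) * u).
  by rewrite -[X in _ - X]mulr1 -uv; ring.
apply: congM phig2; apply/dvdpP; exists ((g1 - g2) * v).
by rewrite -[X in _ - X]mulr1 -uv; ring.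
Qed.

Section RootOrder.
Variables (F : finFieldType) (M t : nat).
Local Notation q := #|F|.
Hypotheses (M_pr : prime M) (t_gt0 : (0 < t)%N)
  (tP : forall k, (M %| (q ^ k).-1)%N = (t %| k)%N).

Let q_gt1 : (1 < q)%N := finNzRing_gt1 F.
Local Notation a := (logn M (q ^ t).-1).

(** A nontrivial root of unity of M-power order lies in an extension of degree
    d only if M divides q^d - 1, so that t divides d.  Then M^a divides q^d - 1,
    and an element whose order divides M^b with b < a is an M-th power in the
    cyclic group of order q^d - 1. *)
Lemma root_mod_unity b : coprime M q -> (b < a)%N ->
  exists g : {poly F}, 'X^(M ^ b) - 1 %| g ^+ M - 'X.
Proof.
move=> coMq lt_ba.
apply: root_mod_separable => [|phi irr mon phib].
  by apply/separable_Xn_sub_1/natr_coprime_card; rewrite coprimeXl.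
have Mb_gt0 : (0 < M ^ b)%N by rewrite expn_gt0 prime_gt0.
have nphiX := irredp_ndvdX Mb_gt0 irr phib.
have d_gt0 : (0 < (size phi).-1)%N by rewrite -subn1 subn_gt0 irr.1.
have phid : phi %| 'X^((q ^ (size phi).-1).-1) - 1.
  by rewrite irredp_dvd_Xq1.
have phi_gcd := dvdp_Xn_sub_1_gcd Mb_gt0 nphiX irr phib phid.
case: (boolP (t %| (size phi).-1)%N) => [t_d | nt_d]; last first.
  exists 1; rewrite expr1n -dvdpNr opprB.
  move: phi_gcd; rewrite (_ : gcdn _ _ = 1%N) //.
  by apply/eqP/coprimeXl; rewrite prime_coprime // tP.
have Ma_d : (M ^ b.+1 %| (q ^ (size phi).-1).-1)%N.
  apply: (@dvdn_trans (M ^ a)); first by rewrite dvdn_exp2l.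
  apply: dvdn_trans (pfactor_dvdnn _ _) _.
  by case/dvdnP: t_d => j ->; rewrite mulnC expnM dvdn_pred_predX.
have [L [iota [cardL iota0 iota_surj]]] := irredp_residue_field irr mon.
have Mq : (M %| #|L|.-1)%N by rewrite cardL (dvdn_trans _ Ma_d) // dvdn_exp.
have [|y yM] := @finField_root L M (iota 'X) Mq.
  have /dvdnP[j ->] : (M ^ b %| #|L|.-1 %/ M)%N.
    by rewrite dvdn_divRL // -expnSr cardL.
  have iX : iota 'X ^+ (M ^ b) = 1.
    by apply/eqP; rewrite -subr_eq0 -rmorphXn -[1](rmorph1 iota) -rmorphB iota0.
  by rewrite mulnC exprM iX expr1n.
have [g gy] := iota_surj y; exists g.
by rewrite -iota0 rmorphB rmorphXn /= gy yM subrr.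
Qed.

(** With k = t j and j < M, the quotient of q^k - 1 by q^t - 1 is a geometric
    sum of j terms congruent to 1 modulo M, hence prime to M.  This is where
    the bound M t is needed. *)
Lemma logn_card_pred k : (0 < k < M * t)%N -> (t %| k)%N ->
  logn M (q ^ k).-1 = a.
Proof.
move=> /andP[k_gt0 lt_kMt] /dvdnP[j kE].
have [j_gt0 lt_jM] : (0 < j)%N /\ (j < M)%N.
  by move: k_gt0 lt_kMt; rewrite kE muln_gt0 ltn_pmul2r // => /andP[].
have qt_gt1 : (1 < q ^ t)%N by rewrite -(exp1n t) ltn_exp2r.
have geo_gt0 : (0 < \sum_(i < j) (q ^ t) ^ i)%N.
  by case: (j) j_gt0 => // j' _; rewrite big_ord_recl.
rewrite kE mulnC expnM predn_exp lognM //; last by rewrite -subn1 subn_gt0.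
rewrite [X in (_ + X)%N]logn_coprime ?addn0 // prime_coprime //.
have qt1 : q ^ t = 1 %[mod M].
  apply/eqP; rewrite eqn_mod_dvd ?(ltnW qt_gt1) // subn1 tP //.
rewrite /dvdn -modn_summ.
under eq_bigr => i _ do rewrite -modnXm qt1 modnXm exp1n.
rewrite modn_summ sum_nat_const card_ord muln1 modn_small //.
by rewrite -lt0n.
Qed.

Definition root_order_part :=
  (\prod_(k <- index_iota 1 (M * t)) ((q ^ k).-1)`_M^')%N.
(** The largest order, up to prime-to-M factors, that an eigenvalue of an M-th
    power can have: one factor M is missing from the M-part of q^t - 1. *)
Definition root_order := (M ^ a.-1 * root_order_part)%N.

Lemma root_order_part_pnat : M^'.-nat root_order_part.
Proof.
rewrite /root_order_part; elim/big_ind: _ => // [m n|k _];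
  last exact: part_pnat.
by rewrite pnatM => -> ->.
Qed.

Lemma root_exp_gt0 : (0 < a)%N.
Proof.
rewrite logn_gt0 mem_primes M_pr tP dvdnn andbT -subn1 subn_gt0.
by rewrite -(exp1n t) ltn_exp2r.
Qed.

Lemma card_pred_gt0 k : (0 < k)%N -> (0 < (q ^ k).-1)%N.
Proof. by move=> k_gt0; rewrite -subn1 subn_gt0 -(exp1n k) ltn_exp2r. Qed.

Lemma root_order_gt0 : (0 < root_order)%N.
Proof.
by rewrite muln_gt0 expn_gt0 prime_gt0 //; case/andP: root_order_part_pnat.
Qed.

Lemma dvdn_root_order_part k : (0 < k < M * t)%N ->
  (((q ^ k).-1)`_M^' %| root_order_part)%N.
Proof.
move=> k_int; rewrite /root_order_part (bigD1_seq k) ?iota_uniq ?mem_index_iota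
  //=.
exact: dvdn_mulr.
Qed.

Lemma coprime_root_order : coprime M q -> coprime root_order q.
Proof.
move=> coMq; rewrite coprimeMl coprimeXl //= /root_order_part.
rewrite big_seq_cond; elim/big_ind: _ => [|m n|k]; first exact: coprime1n.
  by rewrite coprimeMl => -> ->.
rewrite andbT mem_index_iota => /andP[k_gt0 _].
apply: (@coprime_dvdl _ (q ^ k).-1); first exact: dvdn_part.
apply: (@coprime_dvdr _ (q ^ k)); first by rewrite dvdn_exp.
by rewrite coprimePn // expn_gt0 ltnW.
Qed.

(** When t divides k, q^k - 1 has exactly one factor M more than r provides,
    and otherwise it is prime to M and divides r. *)
Lemma gcdn_root_order k : (0 < k < M * t)%N ->
  (gcdn root_order (q ^ k).-1 * M ^ (t %| k) = (q ^ k).-1)%N.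
Proof.
move=> k_int; have /andP[k_gt0 _] := k_int.
have N_gt0 := card_pred_gt0 k_gt0.
have dvd := dvdn_root_order_part k_int.
have NE := partnC M N_gt0; rewrite p_part in NE.
have [t_k | nt_k] := boolP (t %| k)%N; last first.
  rewrite muln1; apply/gcdn_idPr.
  apply: dvdn_trans (dvdn_mull _ dvd); rewrite -[X in (X %| _)%N]NE.
  by rewrite logn_coprime ?mul1n // prime_coprime // tP.
rewrite logn_card_pred // in NE.
have Ma : (M ^ a = M ^ a.-1 * M)%N by rewrite -expnSr prednK // root_exp_gt0.
rewrite /root_order -[X in gcdn _ X]NE Ma -mulnA -muln_gcdr Gauss_gcdr;
  last first.
  by rewrite coprime_sym (pnat_coprime _ root_order_part_pnat) // pnat_id.
by rewrite (gcdn_idPr dvd) mulnAC -Ma NE.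
Qed.

Lemma dvdn_card_pred k : (0 < k < M * t)%N -> ((q ^ k).-1 %| M * root_order)%N.
Proof.
move=> k_int; rewrite -(gcdn_root_order k_int) mulnC dvdn_mul ?dvdn_gcdl //.
by case: (t %| k)%N; rewrite ?dvd1n // expn1.
Qed.

End RootOrder.

Lemma char_poly_ndvdX (F : fieldType) n (y : 'M[F]_n) phi : y \in unitmx ->
  irreducible_poly phi -> phi %| char_poly y -> ~~ (phi %| 'X).
Proof.
move=> Uy irr phiy; apply/negP=> phiX.
have : coprimep (char_poly y) 'X.
  rewrite -['X]subr0 coprimep_XsubC rootE horner_coef0 char_poly_det.
  by rewrite mulf_neq0 ?expf_neq0 ?oppr_eq0 ?oner_eq0 // -unitfE -unitmxE.
move/coprimepP/(_ _ phiy phiX); rewrite -size_poly_eq1 => /eqP size1.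
by have := irr.1; rewrite size1.
Qed.

Section Powers.
Variables (F : finFieldType) (M t : nat).
Local Notation q := #|F|.
Hypotheses (M_pr : prime M) (t_gt0 : (0 < t)%N)
  (tP : forall k, (M %| (q ^ k).-1)%N = (t %| k)%N).
Local Notation r := (root_order F M t).
Local Notation good := (radical_divides ('X^r - 1 : {poly F})).

Let r_gt0 : (0 < r)%N.
Proof. exact: root_order_gt0. Qed.

(** The eigenvalues of y have degree at most the size of y, less than M t, so
    y^(M r) - 1 = (y^M)^r - 1 is nilpotent. *)
Lemma char_poly_power_good n (y : 'M[F]_n.+1) : (n.+1 < M * t)%N ->
  y \in unitmx -> good (char_poly (y ^+ M)).
Proof.
move=> lt_n Uy; set h := char_poly y.
have h_neq0 : h != 0 := monic_neq0 (char_poly_monic y).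
have hdvd : h %| ('X^(M * r) - 1) ^+ (size h).-1.
  apply: irredp_dvd_all => // phi irr mon phih.
  have nphiX := char_poly_ndvdX Uy irr phih.
  have d_gt0 : (0 < (size phi).-1)%N by rewrite -subn1 subn_gt0 irr.1.
  have d_lt : ((size phi).-1 < M * t)%N.
    apply: leq_ltn_trans lt_n; rewrite -ltnS prednK ?(ltnW irr.1) //.
    by rewrite -(size_char_poly y) dvdp_leq.
  have : phi %| 'X^((q ^ (size phi).-1).-1) - 1 by rewrite irredp_dvd_Xq1.
  move/dvdp_trans; apply; apply: dvdp_Xn_sub_1.
  by apply: (dvdn_card_pred M_pr t_gt0 tP); rewrite d_gt0.
have : horner_mx (y ^+ M) (('X^r - 1) ^+ (size h).-1) = 0.
  case/dvdpP: hdvd => g /(congr1 (horner_mx y)).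
  rewrite rmorphM /= (Cayley_Hamilton y) mulr0 => <-.
  by rewrite !rmorphXn !rmorphB !rmorphXn !rmorph1 /= !horner_mx_X exprM.
move/char_poly_dvd_exp; rewrite -exprM => dvd.
apply/radical_dividesP=> [|phi irr mon phix].
  exact: monic_neq0 (char_poly_monic _).
exact: irredp_dvd_exp irr (dvdp_trans phix dvd).
Qed.

(** A power Q of the characteristic removes the unipotent part: x^(r Q) = 1.
    Then x^(r' Q) is killed by M^(a-1) and has an M-th root z that is a
    polynomial in x; as r' Q is prime to M, x itself is a product of powers of
    x^M and z^M. *)
Lemma good_char_poly_power n (x : 'M[F]_n.+1) : coprime M q ->
  good (char_poly x) ->
  exists y, y ^+ M = x.
Proof.
move=> coMq xgood; have [p chp _] := pnat_card_finField F.
have p_gt1 := prime_gt1 (pcharf_prime chp).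
(* Raising to the power Q is additive in characteristic p, and Q is at least
   the exponent n.+1 of X^r - 1 in the definition of goodness. *)
pose Q := (p ^ n.+1)%N; have Q_gt0 : (0 < Q)%N by rewrite expn_gt0 ltnW.
have pQ : [pchar F].-nat Q.
  by rewrite (eq_pnat _ (pcharf_eq chp)) pnatX pnat_id ?(pcharf_prime chp).
have xN : horner_mx x ('X^(r * Q) - 1) = 0.
  have -> : 'X^(r * Q) - 1 = ('X^r - 1) ^+ Q :> {poly F}.
    apply/eqP; rewrite exprM subr_eq -[X in _ + X](expr1n _ Q) -exprDn_pchar
      ?subrK //.
    by rewrite (eq_pnat _ (pchar_poly F)).
  have : char_poly x %| ('X^r - 1) ^+ Q.
    apply: dvdp_trans xgood _; rewrite dvdp_exp2l // size_char_poly /=.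
    by rewrite ltnW // ltn_expl.
  by case/dvdpP=> g ->; rewrite rmorphM /= Cayley_Hamilton mulr0.
pose b := (logn M (q ^ t).-1).-1.
have b_lt : (b < logn M (q ^ t).-1)%N by rewrite prednK // (root_exp_gt0 M_pr
  t_gt0 tP).
have [g gM] := root_mod_unity M_pr tP coMq b_lt.
pose r' := root_order_part F M t.
have co_rM : coprime (r' * Q) M.
  rewrite coprimeMl; apply/andP; split.
    rewrite coprime_sym (pnat_coprime _ (root_order_part_pnat F M t)) //.
    by rewrite pnat_id.
  rewrite coprimeXl // prime_coprime ?(pcharf_prime chp) //.
  by apply: contraTN (natr_coprime_card coMq); rewrite negbK (dvdn_pcharf chp).
have e_gt0 : (0 < r' * Q)%N.
  by rewrite muln_gt0 Q_gt0 andbT; case/andP: (root_order_part_pnat F M t).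
case: (egcdnP M e_gt0) => u v uv _; rewrite (eqP co_rM) in uv.
pose z := horner_mx x (g \Po 'X^(r' * Q)).
have zM : z ^+ M = x ^+ (r' * Q).
  have dvd : 'X^(r * Q) - 1 %| (g \Po 'X^(r' * Q)) ^+ M - 'X^(r' * Q).
    have := dvdp_comp_poly 'X^(r' * Q) gM.
    rewrite !rmorphB !rmorphXn /= comp_polyX rmorph1 -exprM.
    by rewrite [(_ * M ^ b)%N]mulnC mulnA.
  have : horner_mx x ((g \Po 'X^(r' * Q)) ^+ M - 'X^(r' * Q)) = 0.
    by case/dvdpP: dvd => f ->; rewrite rmorphM /= xN mulr0.
  by rewrite rmorphB !rmorphXn /= horner_mx_X => /eqP; rewrite subr_eq0 => /eqP.
have xN1 : x ^+ (r * Q) = 1.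
  move: xN; rewrite rmorphB rmorphXn /= horner_mx_X rmorph1.
  by move/eqP; rewrite subr_eq0 => /eqP.
have zx i j : GRing.comm (z ^+ i) (x ^+ j).
  apply/commrX/commr_sym/commrX/commr_sym.
  by rewrite -[x in GRing.comm _ x](horner_mx_X x); apply: comm_horner_mx2.
(* Bezout: u r' Q = v M + 1.  The exponent r Q - 1 stands for -1, because
   x^(r Q) = 1. *)
exists (z ^+ u * x ^+ (v * (r * Q).-1)).
have -> : (z ^+ u * x ^+ (v * (r * Q).-1)) ^+ M
    = z ^+ M ^+ u * x ^+ (v * M * (r * Q).-1).
  by rewrite exprMn_comm // -!exprM [(u * M)%N]mulnC mulnAC.
rewrite zM -exprM [(_ * u)%N]mulnC uv -exprD addnAC -mulnS prednK; last first.
  by rewrite muln_gt0 r_gt0.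
by rewrite exprD mulnC exprM xN1 expr1n mul1r.
Qed.

Theorem unit_power_char_poly n (x : 'M[F]_n.+1) : coprime M q ->
  (n.+1 < M * t)%N ->
  (x \in unitmx) && [exists y, (y \in unitmx) && (y ^+ M == x)]
  = good (char_poly x).
Proof.
move=> coMq lt_n; apply/andP/idP => [[_ /existsP[y /andP[Uy /eqP <-]]] | xgood].
  exact: char_poly_power_good.
have Ux : x \in unitmx.
  rewrite unitmxE unitfE; apply/negP=> /eqP x0.
  have Xx : 'X %| char_poly x.
    rewrite -['X]subr0 dvdp_XsubCl rootE horner_coef0 char_poly_det x0 mulr0 //.
  have irrX : irreducible_poly ('X : {poly F}).
    by rewrite -['X]subr0; apply: irredp_XsubC.
  have := irredp_dvd_exp irrX (dvdp_trans Xx xgood).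
  by move/(irredp_ndvdX r_gt0 irrX); rewrite dvdpp.
split=> //; have [y yM] := good_char_poly_power coMq xgood.
apply/existsP; exists y; rewrite yM eqxx andbT.
by move: Ux; rewrite -yM; have := unitrX_pos y (prime_gt0 M_pr);
  rewrite !unfold_in => ->.
Qed.
End Powers.

(** * Partitions *)

(** Insertion is the inverse of the removal of a part. *)
Definition insert_part (i : nat) (l : seq nat) : seq nat := sort geq (i :: l).

Lemma geq_total : total geq. Proof. by move=> m n; apply: leq_total. Qed.
Lemma geq_trans : transitive geq.
Proof. by move=> n m p /= nm pn; apply: leq_trans nm. Qed.
Lemma geq_anti : antisymmetric geq.
Proof. by move=> m n; rewrite andbC => /anti_leq. Qed.

Lemma perm_insert_part i l : perm_eq (insert_part i l) (i :: l).
Proof. by rewrite perm_sort. Qed.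

Lemma insert_part_partition i l m : (0 < i)%N ->
  is_partition m l -> is_partition (i + m) (insert_part i l).
Proof.
move=> i_gt0 /and3P[_ l0 /eqP lm]; have eqp := perm_insert_part i l.
apply/and3P; split; first exact: (sort_sorted geq_total).
  by rewrite (perm_mem eqp) inE negb_or eq_sym -lt0n i_gt0.
by rewrite (perm_sumn eqp) /= lm.
Qed.

Lemma insert_part_rem i l n : is_partition n l -> i \in l ->
  is_partition (n - i) (rem i l) /\ insert_part i (rem i l) = l.
Proof.
move=> /and3P[l_sorted l0 /eqP ln] il; have eqp := perm_to_rem il.
split; last first.
  apply: (sorted_eq geq_trans geq_anti) => //;
    first exact: (sort_sorted geq_total).
  by rewrite (permPl (perm_insert_part _ _)) perm_sym.
apply/and3P; split.
- exact: (subseq_sorted geq_trans (rem_subseq i l)) l_sorted.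
- by apply: contra l0; apply: mem_rem.
- by rewrite -ln (perm_sumn eqp) /= addKn.
Qed.

Lemma insert_part_inj i m : {in partitions m &, injective (insert_part i)}.
Proof.
move=> l l'; rewrite !mem_partitions => /and3P[sl _ _] /and3P[sl' _ _] e.
apply: (sorted_eq geq_trans geq_anti) => //.
by rewrite -(perm_cons i) -(permPl (perm_insert_part i l)) e perm_insert_part.
Qed.

Lemma partitions_with_part i n : (0 < i <= n)%N ->
  perm_eq [seq l <- partitions n | i \in l]
          (map (insert_part i) (partitions (n - i))).
Proof.
move=> /andP[i_gt0 le_in]; apply: uniq_perm.
- by rewrite filter_uniq // uniq_partitions.
- by rewrite map_inj_in_uniq ?uniq_partitions //; apply: insert_part_inj.
move=> l; rewrite mem_filter mem_partitions;
  apply/andP/mapP => [[il ln] | [l' + ->]].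
  have [rem_part insK] := insert_part_rem ln il.
  by exists (rem i l); rewrite ?mem_partitions.
rewrite mem_partitions => /(insert_part_partition i_gt0);
  rewrite subnKC // => ->.
by rewrite (perm_mem (perm_insert_part i l')) mem_head.
Qed.

Lemma centralizer_orderE N l : (sumn l < N)%N ->
  centralizer_order l
  = (\prod_(1 <= i < N) (i ^ part_mult i l * (part_mult i l)`!))%N.
Proof.
move=> lt_lN; rewrite /centralizer_order [RHS](big_cat_nat (n :=
  (sumn l).+1)) //=.
rewrite -[LHS]muln1; congr (_ * _)%N.
rewrite big_nat_cond big1 // => i; rewrite andbT => /andP[lt_li _].
rewrite /part_mult (count_memPn _) //; apply/negP=> il.
by have := perm_sumn (perm_to_rem il); rewrite /= => e; move: lt_li;
  rewrite e ltnNge leq_addr.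
Qed.

(** Passing from multiplicity m to m + 1 multiplies i^m m! by i (m + 1). *)
Lemma centralizer_order_insert i l n : (0 < i <= n)%N ->
  is_partition (n - i) l ->
  centralizer_order (insert_part i l)
  = (i * part_mult i (insert_part i l) * centralizer_order l)%N.
Proof.
move=> /andP[i_gt0 le_in] l_part; have /and3P[_ _ /eqP ln] := l_part.
have eqp := perm_insert_part i l.
have multE j : part_mult j (insert_part i l) = ((i == j) + part_mult j l)%N.
  by rewrite /part_mult (seq.permP eqp).
rewrite (@centralizer_orderE n.+1); last first.
  by rewrite (perm_sumn eqp) /= ln subnKC.
rewrite (@centralizer_orderE n.+1) ?ltnS ?ln ?leq_subr //.
rewrite !(bigD1_seq i) ?iota_uniq ?mem_index_iota ?i_gt0 ?ltnS //=.
rewrite !multE eqxx add1n expnS factS !mulnA; congr (_ * _)%N.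
  by rewrite -!mulnA; congr (_ * _)%N; rewrite mulnCA.
by apply: eq_bigr => j j_i; rewrite multE eq_sym (negPf j_i).
Qed.

Lemma sumn_part_mult l N : 0%N \notin l -> all (leq^~ N) l ->
  sumn l = (\sum_(i < N) i.+1 * part_mult i.+1 l)%N.
Proof.
elim: l => [|x l IHl] /=; first by rewrite big1 // => i _; rewrite muln0.
rewrite inE negb_or => /andP[x0 l0] /andP[le_xN lN].
have x_gt0 : (0 < x)%N by rewrite lt0n eq_sym.
under eq_bigr => i _ do rewrite /part_mult /= mulnDr.
rewrite big_split /= -IHl //; congr (_ + _)%N.
have lt_x : (x.-1 < N)%N by rewrite prednK.
rewrite (bigD1 (Ordinal lt_x)) //= prednK // eqxx muln1 big1 ?addn0 // => i i_x.
rewrite (_ : (x == i.+1) = false) ?muln0 //; apply: contraNF i_x => /eqP xi.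
by apply/eqP/val_inj; rewrite /= xi.
Qed.

(** The identity z B' = C B: write n as the sum of i times the multiplicity of
    i in l; this coefficient is exactly what the weight of l loses when one part
    i is removed, except for the factor 1/M when t divides i. *)
Theorem partition_sum_rec M t n : (0 < M)%N ->
  n%:R * \sum_(l <- partitions n) 1 / (M ^ parts_divisible t l *
    centralizer_order l)%:R
  = \sum_(k < n) (M ^ (t %| k.+1)%N)%:R^-1
     * \sum_(l <- partitions (n - k.+1))
          1 / (M ^ parts_divisible t l * centralizer_order l)%:R :> rat.
Proof.
move=> M_gt0; pose w l : rat :=
  1 / (M ^ parts_divisible t l * centralizer_order l)%:R.
rewrite mulr_sumr -/w.
transitivity (\sum_(l <- partitions n) \sum_(k < n) (k.+1 * part_mult k.+1
  l)%:R * w l).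
  apply: eq_big_seq => l; rewrite mem_partitions => /and3P[_ l0 /eqP ln].
  rewrite -mulr_suml -natr_sum -sumn_part_mult ?ln //.
  by apply/allP=> i il /=; rewrite -ln (perm_sumn (perm_to_rem il)) leq_addr.
rewrite exchange_big; apply: eq_bigr => k _ /=.
have k_int : (0 < k.+1 <= n)%N by rewrite ltn_ord.
rewrite (bigID (fun l => k.+1 \in l)) /= [X in _ + X]big1 ?addr0 => [|l kl];
  last first.
  by rewrite /part_mult (count_memPn kl) muln0 mul0r.
rewrite -big_filter (perm_big _ (partitions_with_part k_int)) big_map mulr_sumr.
apply: eq_big_seq => l; rewrite mem_partitions => l_part.
rewrite /w (centralizer_order_insert k_int l_part).
have -> : parts_divisible t (insert_part k.+1 l) = ((t %| k.+1) +
  parts_divisible t l)%N.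
  by rewrite /parts_divisible (seq.permP (perm_insert_part k.+1 l)).
set c := (k.+1 * _)%N; have c_neq0 : c%:R != 0 :> rat.
  rewrite Num.Theory.pnatr_eq0 -lt0n muln_gt0 /= -has_count has_pred1.
  by rewrite (perm_mem (perm_insert_part _ _)) mem_head.
have cancel_c (A B Z C : rat) : C != 0 ->
    C * (1 / (A * B * (C * Z))) = A^-1 * (1 / (B * Z)).
  move=> C_neq0; rewrite !mul1r !invfM -[_ * _ * (_ * _)]mulrA mulrCA.
  by congr (_ * _); rewrite mulrCA mulVKf.
by rewrite expnD !natrM -natrM cancel_c.
Qed.

(** * Logarithmic derivatives *)

Section LogDerivative.
Variables (R : numFieldType) (N : nat).
Implicit Types (f g b c e : nat -> R).

(** The first N coefficients of z G' = E G, where the constant coefficient of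
    E is 0. *)
Definition log_derivative e g :=
  forall n, (n < N)%N -> n%:R * g n = \sum_(k < n) e k.+1 * g (n - k.+1)%N.

Definition trunc f : {poly R} := \poly_(i < N) f i.
(** A logarithmic derivative z G'/G has no constant term. *)
Definition trunc1 f : {poly R} := \poly_(i < N) (if i == 0%N then 0 else f i).

Lemma coef_trunc_conv e f n : (n < N)%N ->
  (trunc1 e * trunc f)`_n = \sum_(k < n) e k.+1 * f (n - k.+1)%N.
Proof.
move=> lt_nN; rewrite coefM big_ord_recl /= coef_poly if_same mul0r add0r.
apply: eq_bigr => k _; rewrite !coef_poly /bump /= add1n.
by rewrite (leq_ltn_trans (ltn_ord k)) // (leq_ltn_trans (leq_subr _ _)).
Qed.

Lemma dvdp_Xn_coef (p : {poly R}) : reflect (forall n, (n < N)%N ->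
  p`_n = 0) ('X^N %| p).
Proof.
apply: (iffP idP) => [/dvdpP[h ->] n lt_nN | p0];
  first by rewrite coefMXn lt_nN.
rewrite -(poly_take_drop N p) (_ : take_poly N p = 0) ?add0r ?dvdp_mull //.
by apply/polyP=> n; rewrite coef_take_poly coef0; case: ifP => // /p0.
Qed.

Lemma log_derivativeP e g : log_derivative e g <->
  'X^N %| 'X * (trunc g)^`() - trunc1 e * trunc g.
Proof.
have coefE n : (n < N)%N -> ('X * (trunc g)^`() - trunc1 e * trunc g)`_n
    = n%:R * g n - \sum_(k < n) e k.+1 * g (n - k.+1)%N.
  move=> lt_nN; rewrite coefB coef_trunc_conv // coefXM coef_deriv coef_poly.
  by case: n lt_nN => [|n] lt_nN /=; rewrite ?mul0r // lt_nN mulr_natl.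
split=> [eg | /dvdp_Xn_coef eg n lt_nN].
  by apply/dvdp_Xn_coef => n lt_nN; rewrite coefE // eg // subrr.
by apply/eqP; rewrite -subr_eq0 -coefE // eg.
Qed.

Definition conv f g n := \sum_(k < n.+1) f k * g (n - k)%N.

(** The Leibniz rule, modulo z^N. *)
Lemma log_derivativeM e c g b : log_derivative e g -> log_derivative c b ->
  log_derivative (fun k => e k + c k) (conv g b).
Proof.
move=> /log_derivativeP eg /log_derivativeP cb n lt_nN.
have convE m : (m < N)%N -> (trunc g * trunc b)`_m = conv g b m.
  move=> lt_mN; rewrite coefM; apply: eq_bigr => k _; rewrite !coef_poly.
  by rewrite (leq_ltn_trans (leq_ord k) lt_mN) (leq_ltn_trans (leq_subr k m)
    lt_mN).
have : 'X^N %| 'X * (trunc g * trunc b)^`() - (trunc1 e + trunc1 c) * (trunc g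
  * trunc b).
  have -> : 'X * (trunc g * trunc b)^`() - (trunc1 e + trunc1 c) * (trunc g *
    trunc b)
    = ('X * (trunc g)^`() - trunc1 e * trunc g) * trunc b
      + trunc g * ('X * (trunc b)^`() - trunc1 c * trunc b).
    by rewrite derivM; ring.
  by apply: dvdp_add; [apply: dvdp_mulr | apply: dvdp_mull].
move/dvdp_Xn_coef/(_ n lt_nN)/eqP; rewrite coefB subr_eq0 => /eqP.
have -> : ('X * (trunc g * trunc b)^`())`_n = n%:R * conv g b n.
  rewrite coefXM coef_deriv; case: n lt_nN => [|n] lt_nN /=;
    first by rewrite mul0r.
  by rewrite convE // mulr_natl.
move=> ->; rewrite coefM big_ord_recl coefD !coef_poly if_same addr0 mul0r
  add0r.
apply: eq_bigr => k _; rewrite coefD !coef_poly convE /bump /= ?add1n;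
  last first.
  exact: leq_ltn_trans (leq_subr _ _) lt_nN.
by rewrite (leq_ltn_trans (ltn_ord k)).
Qed.

(** Since e_k + c_k = c_k Q^k, the series G(z) B(z) and B(Qz) have the same
    logarithmic derivative, so b solves the equation B(Qz) = G(z) B(z) that
    determines a recursively, as Q^n - 1 is invertible. *)
Theorem dilation_equation_unique (Q : R) a g e c b :
  (forall n, (0 < n)%N -> Q ^+ n != 1) ->
  a 0%N = 1 -> g 0%N = 1 -> b 0%N = 1 ->
  (forall n, (0 < n < N)%N ->
     (Q ^+ n - 1) * a n = \sum_(k < n) g k.+1 * a (n - k.+1)%N) ->
  log_derivative e g -> log_derivative c b ->
  (forall k, (0 < k < N)%N -> e k = c k * (Q ^+ k - 1)) ->
  forall n, (n < N)%N -> a n = b n.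
Proof.
move=> Q1 a0 g0 b0 aE eg cb eE.
have dil n : (n < N)%N -> conv g b n = Q ^+ n * b n.
  elim/ltn_ind: n => -[|n] IHn lt_nN.
    by rewrite /conv big_ord_recl big_ord0 addr0 g0 subn0 b0 expr0 mulr1.
  have n_neq0 : n.+1%:R != 0 :> R by rewrite Num.Theory.pnatr_eq0.
  apply: (mulfI n_neq0); rewrite (log_derivativeM eg cb) // mulrCA cb //.
  rewrite mulr_sumr; apply: eq_bigr => k _.
  have lt_kn := ltn_ord k.
  rewrite IHn ?ltn_subrL ?(leq_ltn_trans (leq_subr _ _) lt_nN) //.
  rewrite eE ?(leq_ltn_trans lt_kn) // -[in Q ^+ n.+1](subnKC lt_kn) exprD.
  ring.
elim/ltn_ind => -[|n] IHn lt_nN; first by rewrite a0 b0.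
have q1 : Q ^+ n.+1 - 1 != 0 by rewrite subr_eq0 Q1.
apply: (mulfI q1); rewrite aE // mulrBl mul1r -dil // /conv [in
  RHS]big_ord_recl.
rewrite /= g0 mul1r subn0 [X in _ = X - _]addrC addrK; apply: eq_bigr => k _.
by rewrite IHn ?ltn_subrL ?(leq_ltn_trans (leq_subr _ _) lt_nN).
Qed.
End LogDerivative.

(** * The proportion of M-th powers *)

Lemma dvdn_pred_order (M q : nat) (u : {unit 'Z_M}) : (1 < M)%N -> (0 < q)%N ->
  val u = q%:R -> forall k, (M %| (q ^ k).-1)%N = (#[u]%g %| k)%N.
Proof.
move=> M_gt1 q_gt0 uE k;
  rewrite order_dvdn -val_eqE FinRing.val_unitX /= uE -natrX.
rewrite -[1 in RHS]/(1%:R) -val_eqE /= !val_Zp_nat // -subn1 -eqn_mod_dvd //.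
  by rewrite Zp_cast.
by rewrite expn_gt0 q_gt0.
Qed.

Lemma card_char0 (F : finFieldType) (P : pred {poly F}) : P 1 ->
  card_char P 0 = 1%N.
Proof.
move=> P1; rewrite -[RHS](card_mx F 0 0 : _ = 1%N) -cardsT; apply: eq_card => x.
by rewrite !inE /char_poly det_mx00.
Qed.

Lemma card_monic0 (F : finFieldType) (P : pred {poly F}) : P 1 ->
  card_monic P 0 = 1%N.
Proof.
move=> P1; rewrite -[RHS](card_mx F 1 0 : _ = 1%N) -cardsT; apply: eq_card => w.
by rewrite !inE /monic_of [w]thinmx0 linear0 subr0.
Qed.

Lemma gl_card0 (F : finFieldType) : gl_card F 0 = 1%N.
Proof.
rewrite -[RHS](card_mx F 0 0 : _ = 1%N) -cardsT; apply: eq_card => x.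
by rewrite !inE unitmxE det_mx00 unitr1.
Qed.

Lemma card_GL_gl_card (F : finFieldType) n : #|'GL_n.+1[F]%g| = gl_card F n.+1.
Proof.
rewrite -(card_imset _ (@val_inj _ _ {'GL_n.+1[F]})); apply: eq_card => x.
rewrite inE; apply/imsetP/idP => [[g _ ->] | Ux]; first exact: (GL_unitmx g).
by exists (FinRing.unit 'M[F]_n.+1 Ux); rewrite ?inE.
Qed.

Lemma partition_sum0 M t :
  \sum_(l <- partitions 0) 1 / (M ^ parts_divisible t l * centralizer_order
    l)%:R
  = 1 :> rat.
Proof.
have perm0 : perm_eq (partitions 0) [:: [::]].
  apply: uniq_perm; rewrite ?uniq_partitions // => l.
  rewrite mem_partitions inE /is_partition; case: l => // x l.
  rewrite inE negb_or /= addn_eq0 eq_sym.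
  by case: eqP => //=; rewrite ?andbF.
rewrite (perm_big _ perm0) big_seq1 /centralizer_order big_geq //.
Qed.

Theorem theorem9p3 (M q : nat) (F : finFieldType) (u : {unit 'Z_M}) (t n : nat)
  (M_prime : prime M) (card_F : #|F| = q) (coMq : coprime M q)
  (uE : val u = q%:R) (tE : t = #[u]%g)
  (n_gt0 : (0 < n)%N) (n_lt : (n < M * t)%N) :
  #|[set (x ^+ M)%g | x in 'GL_n[F]%g]|%:R / #|'GL_n[F]%g|%:R
  = \sum_(l <- partitions n)
      1 / (M ^ parts_divisible t l * centralizer_order l)%:R :> rat.
Proof.
move: coMq uE; rewrite -{q}card_F => coMq uE.
have q_gt1 := finNzRing_gt1 F.
have t_gt0 : (0 < t)%N by rewrite tE order_gt0.
have tP k : (M %| (#|F| ^ k).-1)%N = (t %| k)%N.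
  by rewrite tE; apply: dvdn_pred_order; rewrite ?prime_gt1 // ltnW.
set r := root_order F M t; pose S : {poly F} := 'X^r - 1.
have r_gt0 : (0 < r)%N by apply: root_order_gt0.
have S_neq0 : S != 0 by rewrite -size_poly_eq0 size_XnsubC.
pose good := radical_divides S.
have good1 : good 1 by apply: dvd1p.
have powE : #|[set (x ^+ M)%g | x in 'GL_n[F]%g]| = card_char good n.
  case: n n_gt0 n_lt => // m _ m_lt.
  rewrite -(card_imset _ (@val_inj _ _ {'GL_m.+1[F]})); apply: eq_card => x.
  rewrite [RHS]inE -[RHS](unit_power_char_poly M_prime t_gt0 tP x coMq m_lt).
  apply/imsetP/andP => [[_ /imsetP[y _ ->] ->] | [Ux /existsP[y /andP[Uy /eqP
    yM]]]].
    rewrite FinRing.val_unitX; split.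
      by rewrite -FinRing.val_unitX; apply: (GL_unitmx (y ^+ M)%g).
    by apply/existsP; exists (val y); rewrite eqxx andbT (GL_unitmx y).
  exists (FinRing.unit 'M[F]_m.+1 Ux) => //; apply/imsetP.
  exists (FinRing.unit 'M[F]_m.+1 Uy); first by rewrite inE.
  by apply: val_inj; rewrite FinRing.val_unitX /= yM.
have glE : #|'GL_n[F]%g| = gl_card F n by case: n n_gt0 {n_lt powE} =>
  // m _; apply: card_GL_gl_card.
rewrite powE glE.
pose e k : rat :=
  (\sum_(phi <- irr_factors S | (size phi).-1 %| k) (size phi).-1)%N%:R.
pose c k : rat := (M ^ (t %| k)%N)%:R^-1.
apply: (@dilation_equation_unique _ (M * t) (#|F|%:R)
  (fun m => (card_char good m)%:R / (gl_card F m)%:R)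
  (fun m => (card_monic good m)%:R) e c
  (fun m => \sum_(l <- partitions m)
     1 / (M ^ parts_divisible t l * centralizer_order l)%:R)) => //.
- move=> m m_gt0; rewrite -natrX Num.Theory.pnatr_eq1 -(exp1n m) eqn_exp2r //
  gtn_eqF //.
- by rewrite card_char0 // gl_card0 divr1.
- by rewrite card_monic0.
- exact: partition_sum0.
- move=> m _; apply: card_char_rec; exact: radical_dividesM.
- move=> m _; rewrite -natrM card_monic_rec // natr_sum; apply: eq_bigr => k _.
  by rewrite natrM.
- by move=> m _; apply: partition_sum_rec; rewrite prime_gt0.
move=> k k_int; have /andP[k_gt0 _] := k_int.
rewrite /e sum_degree_irr_factors ?coprime_root_order //.
have M_neq0 : (M ^ (t %| k)%N)%:R != 0 :> rat.
  by rewrite Num.Theory.pnatr_eq0 -lt0n expn_gt0 prime_gt0.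
apply: (mulfI M_neq0); rewrite mulVKf // -natrM mulnC.
by rewrite (gcdn_root_order M_prime t_gt0 tP k_int) -subn1 natrB ?natrX //
  expn_gt0 ltnW.
Qed.
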